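(* Let $\Phi$ be a stationary point process on $\mathbf{R}^N$ having all finite moments and let $\Theta$ be its probability distribution. Assume that for every compact set $\Lambda\subset\mathbf{R}^N$ the restriction $\Theta|_\Lambda$ is absolutely continuous with respect to $\Pi|_\Lambda$ and that the Radon–Nikodym density $d\Theta|_\Lambda/d\Pi|_\Lambda$ is strictly positive $\Pi|_\Lambda$-almost surely, where $\Pi$ is the distribution of a homogeneous Poisson point process on $\mathbf{R}^N$. In addition, assume that $\kappa$ on $\mathscr{F}(\mathbf{R}^N)$ is Lipschitz continuous with respect to the Hausdorff distance. Then $$\operatorname{supp}\nu_q=\overline{R_q(\kappa)}.$$
   Context: Fix integers $N\ge 1$, $q\ge 0$ and a field $\mathbf{F}$; all homology is simplicial homology with coefficients in $\mathbf{F}$. The function $\kappa$. Let $\mathscr{F}(\mathbf{R}^N)$ be the set of all nonempty finite subsets of $\mathbf{R}^N$. A function $f$ on $\mathscr{F}(\mathbf{R}^N)$ is measurable if for each $k\ge1$ the permutation-invariant function $(x_1,\dots,x_k)\mapsto f(\{x_1,\dots,x_k\})$ on $(\mathbf{R}^N)^k$ is measurable. Fix a measurable function $\kappa:\mathscr{F}(\mathbf{R}^N)\to[0,\infty]$ such that: (K1) $0\le\kappa(\sigma)\le\kappa(\tau)$ if $\sigma\subset\tau$; (K2) $\kappa(\sigma+x)=\kappa(\sigma)$ for all $x\in\mathbf{R}^N$; (K3) there is an increasing function $\rho:[0,\infty]\to[0,\infty]$ with $\rho(t)<\infty$ for $t<\infty$ such that $\|x-y\|\le\rho(\kappa(\{x,y\}))$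 for all $x,y$ (Euclidean norm); normalized by $\kappa(\{x\})=0$. Lipschitz continuity with respect to the Hausdorff distance $d_H$ means that there is a constant $c_\kappa$ with $|\kappa(\sigma)-\kappa(\sigma')|\le c_\kappa\, d_H(\sigma,\sigma')$ for all $\sigma,\sigma'\in\mathscr{F}(\mathbf{R}^N)$. The filtration. For a finite set $\Xi\subset\mathbf{R}^N$ and $t\ge 0$, let $K(\Xi,t)$ be the simplicial complex of all nonempty $\sigma\subset\Xi$ with $\kappa(\sigma)\le t$. Persistence diagram. The persistent homology $(H_q(K(\Xi,t)))_{t\ge 0}$ with the maps induced by inclusions decomposes uniquely as $\bigoplus_{i=1}^{p} I(b_i,d_i)$ with $0\le b_i<d_i\le\infty$, where $I(b,d)$ is $\mathbf{F}$ at parameters $b\le t<d$ (with identity maps between them) and $0$ otherwise. Let $\Delta=\{(x,y)\in[0,\infty]^2: 0\le x<y\le\infty\}$ (with the subspace topology from $[0,\infty]^2$) and $\xi_q(\Xi)=\sum_{i=1}^p\delta_{(b_i,d_i)}$. Realizable points. $R_q(\kappa)$ is the set of all $(b,d)\in\Delta$ for which there is $\Xi\in\mathscr{F}(\mathbf{R}^N)$ with $\xi_q(\Xi)(\{(b,d)\})\ge1$; the bar denotes closure in $\Delta$. Point processes. A point process on $\mathbf{R}^N$ is a random integer-valued Radon measure; $\Phi$ is always assumed simple (almost surely $\Phi(\{x\})\le1$ for every $x$) and identified with its set of points. It is stationary if its law is translation invariant, and has all finite moments if $\mathbb{E}[\Phi(A)^k]<\infty$ for all bounded Borel $A$ and $k=1,2,\dots$.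 $\Phi_\Lambda$ is the restriction of $\Phi$ to $\Lambda$, and $\Theta|_\Lambda$ (resp. $\Pi|_\Lambda$) is the distribution of the restriction to $\Lambda$ of a point process with distribution $\Theta$ (resp. $\Pi$). The measure $\nu_q$. Let $\Lambda_L=[-\frac L2,\frac L2)^N$ and $\xi_{q,L}=\xi_q(\Phi_{\Lambda_L})$. $\nu_q$ is the unique Radon measure on $\Delta$ such that $L^{-N}\mathbb{E}[\xi_{q,L}]\to\nu_q$ vaguely as $L\to\infty$ (i.e. integrals of continuous compactly supported functions on $\Delta$ converge); it exists for every stationary $\Phi$ with all finite moments. *)

(* Defs.v *)
From HB Require Import structures.
From mathcomp Require Import all_boot all_order all_algebra finmap.
From mathcomp Require Import generic_quotient ring_quotient.
From mathcomp Require Import all_classical all_reals all_analysis.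
From mathcomp Require Import measurable_realfun.

Set Implicit Arguments.
Unset Strict Implicit.
Unset Printing Implicit Defensive.

Import Order.TTheory GRing.Theory Num.Theory.
Import numFieldNormedType.Exports.

Local Open Scope classical_set_scope.
Local Open Scope ring_scope.

Section QuotientSpace.
Variables (F : fieldType) (V : vectType F) (U : {vspace V}).
Local Open Scope quotient_scope.

Definition quotv := Quotient.quot (pred_of_vspace U).

HB.instance Definition _ := GRing.Zmodule.on quotv.

Definition quotv_class (x : V) : quotv := \pi x.
Definition quotv_repr (x : quotv) : V := repr x.
Definition quotv_scale (a : F) (x : quotv) := quotv_class (a *: quotv_repr x).

Lemma quotv_reprK : cancel quotv_repr quotv_class.
Proof. exact: reprK. Qed.

Lemma quotv_classP (x y : V) :
  reflect (quotv_class x = quotv_class y) (x - y \in U).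
Proof.
rewrite -[x - y \in U]/(_ \in pred_of_vspace U) Quotient.idealrBE.
exact: eqP.
Qed.

Lemma quotv_classD (x y : V) :
  quotv_class (x + y) = quotv_class x + quotv_class y.
Proof. exact: Quotient.pi_add. Qed.

Lemma quotv_scale_class a (x : V) :
  quotv_scale a (quotv_class x) = quotv_class (a *: x).
Proof. by apply/quotv_classP; rewrite -scalerBr memvZ//; apply/quotv_classP/quotv_reprK. Qed.

Lemma quotv_scaleA a b x :
  quotv_scale a (quotv_scale b x) = quotv_scale (a * b) x.
Proof. by rewrite -(quotv_reprK x) !quotv_scale_class scalerA. Qed.

Lemma quotv_scale1 : left_id 1 quotv_scale.
Proof. by move=> x; rewrite -(quotv_reprK x) quotv_scale_class scale1r. Qed.

Lemma quotv_scaleDr : right_distributive quotv_scale +%R.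
Proof.
move=> a x y; rewrite -(quotv_reprK x) -(quotv_reprK y) -quotv_classD.
by rewrite !quotv_scale_class scalerDr quotv_classD.
Qed.

Lemma quotv_scaleDl x : {morph quotv_scale^~ x : a b / a + b}.
Proof.
move=> a b; rewrite -(quotv_reprK x) !quotv_scale_class scalerDl.
exact: quotv_classD.
Qed.

HB.instance Definition _ := GRing.Zmodule_isLmodule.Build F quotv
  quotv_scaleA quotv_scale1 quotv_scaleDr quotv_scaleDl.

Lemma quotv_class_is_linear : linear quotv_class.
Proof.
by move=> a x y; rewrite quotv_classD -quotv_scale_class.
Qed.

HB.instance Definition _ :=
  GRing.isLinear.Build F V quotv *:%R quotv_class quotv_class_is_linear.

End QuotientSpace.

Section QuotientMap.
Variables (F : fieldType) (V V' : vectType F).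
Variables (U : {vspace V}) (U' : {vspace V'}) (f : {linear V -> V'}).
Hypothesis fU : forall x, x \in U -> f x \in U'.

Definition quotv_map of (forall x, x \in U -> f x \in U') :=
  fun x : quotv U => quotv_class U' (f (quotv_repr x)).

Lemma quotv_map_class x :
  quotv_map fU (quotv_class U x) = quotv_class U' (f x).
Proof.
apply/quotv_classP; rewrite -raddfB fU//.
exact/quotv_classP/quotv_reprK.
Qed.

Lemma quotv_map_is_linear : linear (quotv_map fU).
Proof.
move=> a x y; rewrite -(quotv_reprK x) -(quotv_reprK y) -linearP.
by rewrite !quotv_map_class !linearP.
Qed.

HB.instance Definition _ :=
  GRing.isLinear.Build F (quotv U) (quotv U') *:%R (quotv_map fU)
    quotv_map_is_linear.

End QuotientMap.

Section Homology.
Variables (F : fieldType) (V : finType).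
Implicit Types (K : {set {set V}}) (s : {set V}).

Definition chain := {ffun {set V} -> F^o}.

Definition simplex_chain s : chain := [ffun s' => (s' == s)%:R].

Definition chains (q : nat) K : {vspace chain} :=
  <<[seq simplex_chain s | s <- enum K & #|s| == q.+1]>>%VS.

(* Simplices are oriented by the order of [enum V]: the vertex [v] is deleted
   from [s] with the sign (-1)^i, where i is the position of [v] in [s].  The
   empty face is discarded, so that the homology is not reduced. *)
Definition vertex_pos s (v : V) := #|[pred w in s | enum_rank w < enum_rank v]|%N.

Definition simplex_boundary s : chain :=
  \sum_(v in s | s :\ v != finset.set0)
    (-1) ^+ vertex_pos s v *: simplex_chain (s :\ v).

Definition boundary_fun (c : chain) : chain :=
  \sum_s (c s : F) *: simplex_boundary s.

Lemma boundary_fun_is_linear : linear boundary_fun.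
Proof.
move=> a c d; rewrite /boundary_fun scaler_sumr -big_split; apply: eq_bigr => s _.
by rewrite !ffunE scalerDl scalerA.
Qed.

HB.instance Definition _ :=
  GRing.isLinear.Build F chain chain *:%R boundary_fun boundary_fun_is_linear.

Definition boundary : 'End(chain) := linfun boundary_fun.

Definition cycles q K := (chains q K :&: lker boundary)%VS.
Definition boundaries q K := (boundary @: chains q.+1 K)%VS.

Definition boundaries_in_cycles q K : {vspace subvs_of (cycles q K)} :=
  (linfun (@vsval _ _ (cycles q K)) @^-1: boundaries q K)%VS.

Definition homology q K := quotv (boundaries_in_cycles q K).

Lemma chainsS q K K' : K \subset K' -> (chains q K <= chains q K')%VS.
Proof.
move=> sK; apply: sub_span => c /mapP[s].
rewrite mem_filter mem_enum => /andP[qs Ks] ->.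
by apply: map_f; rewrite mem_filter mem_enum qs (fintype.subsetP sK).
Qed.

Definition cycle_incl q K K' (z : subvs_of (cycles q K)) :
  subvs_of (cycles q K') := vsproj (cycles q K') (vsval z).

Lemma cycle_incl_is_linear q K K' : linear (@cycle_incl q K K').
Proof. by move=> a x y; rewrite /cycle_incl !linearP. Qed.

HB.instance Definition _ q K K' :=
  GRing.isLinear.Build F _ _ *:%R (@cycle_incl q K K') (@cycle_incl_is_linear q K K').

Lemma cycle_inclK q K K' (z : subvs_of (cycles q K)) : K \subset K' ->
  vsval (cycle_incl K' z) = vsval z.
Proof.
move=> sK; apply: vsprojK; apply: subvP (subvsP z).
by rewrite capvS// chainsS.
Qed.

Lemma cycle_incl_boundaries q K K' : K \subset K' ->
  forall z, z \in boundaries_in_cycles q K ->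
    cycle_incl K' z \in boundaries_in_cycles q K'.
Proof.
move=> sK z; rewrite -!memv_preim !lfunE/= cycle_inclK//.
by apply/subvP/limgS/chainsS.
Qed.

Definition homology_map q K K' (sK : K \subset K') :
    {linear homology q K -> homology q K'} :=
  quotv_map (cycle_incl_boundaries (q := q) sK).

End Homology.

(* Persistence modules are indexed by the reals; only the indices t >= 0 are
   used below. *)
Record persmod (R : realType) (F : fieldType) := Persmod {
  pm_space :> R -> lmodType F ;
  pm_map : forall s t, s <= t -> {linear pm_space s -> pm_space t} }.

Section Diagram.
Variables (R : realType) (F : fieldType).
Implicit Types (M : persmod R F) (p : \bar R * \bar R).

Definition alive p (t : R) : bool := (p.1 <= t%:E)%E && (t%:E < p.2)%E.

(* The space of I(b, d) at t is F^1 if b <= t < d and F^0 otherwise; [pid_mx 1]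
   is the identity of F^1 if the interval is alive at both ends and 0
   otherwise. *)
Definition interval_module p : persmod R F :=
  @Persmod R F (fun t => 'rV[F]_(alive p t))
    (fun s t _ => mulmxr (pid_mx 1 : 'M[F]_(alive p s, alive p t))).

Definition Delta : set (\bar R * \bar R) :=
  [set p | (0 <= p.1)%E /\ (p.1 < p.2)%E].

(* An isomorphism from M to the direct sum of the I(b_i, d_i), given by its
   components; the list ds enumerates the pairs (b_i, d_i) with multiplicity. *)
Definition decomposes M (ds : seq (\bar R * \bar R)) : Prop :=
  (forall p, p \in ds -> Delta p) /\
  exists phi : forall (t : R) (i : 'I_(size ds)),
      {linear M t -> interval_module (tnth (in_tuple ds) i) t},
    (forall t : R, 0 <= t -> bijective (fun (h : M t) i => phi t i h)) /\
    (forall s t (st : s <= t) i (h : M s), 0 <= s ->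
      phi t i (pm_map M st h) = pm_map (interval_module _) st (phi s i h)).

(* The decomposition is unique up to the order of the list, so that the counting
   measure of the diagram does not depend on the choice made by [xget]. *)
Definition diagram M : seq (\bar R * \bar R) := xget [::] [set ds | decomposes M ds].

Definition diagram_measure M (A : set (\bar R * \bar R)) : \bar R :=
  (\sum_(p <- diagram M) \d_p A)%E.

End Diagram.

Section Filtration.
Variables (R : realType) (N : nat).
Implicit Types (x y : 'rV[R]_N) (sigma tau Xi : {fset 'rV[R]_N}).
Variable kappa : {fset 'rV[R]_N} -> \bar R.

Definition enorm x : R := Num.sqrt (\sum_i x ord0 i ^+ 2).

(* The value of kappa at the empty set plays no role. *)
Record filtration_function : Prop := FiltrationFunction {
  kappa_measurable : forall k, (0 < k)%N ->
    measurable_fun [set: g_sigma_algebraType (@open 'M[R]_(k, N))]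
      (fun x : 'M[R]_(k, N) => kappa [fset row i x | i : 'I_k]%fset) ;
  kappa_ge0 : forall sigma, sigma != fset0 -> (0 <= kappa sigma)%E ;
  kappa_mono : forall sigma tau, sigma != fset0 -> (sigma `<=` tau)%fset ->
    (kappa sigma <= kappa tau)%E ;
  kappa_translation : forall sigma x, sigma != fset0 ->
    kappa [fset (y + x)%R | y in sigma]%fset = kappa sigma ;
  kappa_rho : exists rho : \bar R -> \bar R,
    [/\ forall t, (0 <= t)%E -> (0 <= rho t)%E,
        forall s t, (0 <= s)%E -> (s <= t)%E -> (rho s <= rho t)%E,
        forall t, (0 <= t)%E -> (t < +oo)%E -> (rho t < +oo)%E &
        forall x y, ((enorm (x - y))%:E <= rho (kappa [fset x; y]%fset))%E ] ;
  kappa_point : forall x, kappa [fset x]%fset = 0%E }.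

Definition hausdorff_dist sigma tau : R :=
  Num.max
    (sup [set inf [set enorm (x - y) | y in [set` tau]] | x in [set` sigma]])
    (sup [set inf [set enorm (x - y) | x in [set` sigma]] | y in [set` tau]]).

Definition hausdorff_lipschitz : Prop :=
  exists c : R, forall sigma tau, sigma != fset0 -> tau != fset0 ->
    (`|kappa sigma - kappa tau| <= (c * hausdorff_dist sigma tau)%:E)%E.

Definition cplx Xi (t : R) : {set {set Xi}} :=
  [set s : {set Xi} |
    (s != finset.set0) && (kappa [fset val x | x in s]%fset <= t%:E)%E]%SET.

Lemma cplxS Xi s t : s <= t -> cplx Xi s \subset cplx Xi t.
Proof.
move=> st; apply/fintype.subsetP => sigma; rewrite !inE => /andP[-> /= le_s].
by apply: le_trans le_s _; rewrite lee_fin.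
Qed.

Variables (F : fieldType) (q : nat).

Definition persistent_homology Xi : persmod R F :=
  @Persmod R F (fun t => homology F q (cplx Xi t))
    (fun s t st => homology_map F q (cplxS Xi st)).

Definition xi Xi : set (\bar R * \bar R) -> \bar R :=
  diagram_measure (persistent_homology Xi).

Definition realizable : set (\bar R * \bar R) :=
  [set p | Delta p /\
    exists2 Xi : {fset 'rV[R]_N}, Xi != fset0 & (1 <= xi Xi [set p])%E].

End Filtration.

Section Configurations.
Variables (R : realType) (N : nat).

Definition euclid := g_sigma_algebraType (@open 'rV[R]_N).
HB.instance Definition _ := Measurable.on euclid.

(* Integer-valued Radon measures: local finiteness is the finiteness on bounded
   Borel sets, where integrality is required as well. *)
Record configuration := Configuration {
  cfg_measure :> {measure set euclid -> \bar R} ;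
  cfg_integer : forall A : set euclid, measurable A ->
    bounded_set (A : set 'rV[R]_N) -> exists n : nat, cfg_measure A = n%:R%:E }.

Lemma cfg0_integer (A : set euclid) : measurable A ->
  bounded_set (A : set 'rV[R]_N) ->
  exists n : nat, (mzero : {measure set euclid -> \bar R}) A = n%:R%:E.
Proof. by exists 0%N. Qed.

HB.instance Definition _ := gen_eqMixin configuration.
HB.instance Definition _ := gen_choiceMixin configuration.
HB.instance Definition _ := isPointed.Build configuration (Configuration cfg0_integer).

Definition cfg_generators : set (set configuration) :=
  \bigcup_(A in @measurable _ euclid)
    preimage_set_system [set: configuration] (fun mu => cfg_measure mu A) measurable.

Definition cfg_display : measure_display. Proof. by constructor. Qed.

HB.instance Definition _ :=
  @isMeasurable.Build cfg_display configuration <<s cfg_generators >>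
    (@sigma_algebra0 _ setT cfg_generators)
    (@sigma_algebraC _ cfg_generators)
    (@sigma_algebra_bigcup _ setT cfg_generators).

Lemma measurable_cfg_eval (A : set euclid) : measurable A ->
  measurable_fun [set: configuration] (fun mu => cfg_measure mu A).
Proof.
move=> mA _ B mB; apply: sub_sigma_algebra; exists A => //.
by exists B.
Qed.

Lemma measurable_to_configuration (f : configuration -> configuration) :
  (forall A : set euclid, measurable A ->
    measurable_fun [set: configuration] (fun mu => f mu A)) ->
  measurable_fun [set: configuration] f.
Proof.
move=> mf; apply: (measurability cfg_generators) => //.
move=> _ [_ [A mA [B mB <-]] <-]; rewrite setTI.
exact: mf.
Qed.

Section Translation.
Variable a : 'rV[R]_N.

Definition shift_point (x : euclid) : euclid := (x : 'rV[R]_N) + a.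

Lemma measurable_shift_point : measurable_fun [set: euclid] shift_point.
Proof.
apply: (measurability (@open 'rV[R]_N : set (set euclid))) => //.
move=> _ [B oB <-]; rewrite setTI.
have cont : continuous (fun x : 'rV[R]_N => x + a).
  by move=> x; apply: (@cvgD _ _ _ (nbhs x) _ (fun y => y) (fun=> a)); [move=> ? |exact: cvg_cst].
by apply: sub_gen_smallest; move/continuousP : cont; exact.
Qed.

Section ShiftedMeasure.
Variable mu : configuration.

Definition shift_measure : set euclid -> \bar R := pushforward mu shift_point.

Let shift0 : shift_measure set0 = 0%E.
Proof. by rewrite /shift_measure /pushforward preimage_set0 measure0. Qed.

Let shift_ge0 A : (0 <= shift_measure A)%E.
Proof. exact: (measure_ge0 (cfg_measure mu) (shift_point @^-1` A)). Qed.

Let shift_sigma_additive : semi_sigma_additive shift_measure.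
Proof.
have mf := measurable_shift_point.
exact: (@measure_semi_sigma_additive _ _ _ (pushforward mu shift_point)).
Qed.

HB.instance Definition _ := isMeasure.Build _ _ _ shift_measure
  shift0 shift_ge0 shift_sigma_additive.

Lemma shift_integer (A : set euclid) :
  measurable A -> bounded_set (A : set 'rV[R]_N) ->
  exists n : nat, shift_measure A = n%:R%:E.
Proof.
move=> mA bA; apply: cfg_integer.
  by rewrite -[X in measurable X]setTI; exact: measurable_shift_point.
move: bA => [M [Mr MA]]; exists (M + `|a|); split; first exact: num_real.
move=> x Mx y Ay; rewrite -(addrK a y); apply: le_trans (ler_normB _ _) _.
by rewrite -lerBrDr; apply: (MA (x - `|a|)) => //; rewrite ltrBrDr.
Qed.

Definition cfg_shift : configuration :=
  @Configuration shift_measure shift_integer.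

End ShiftedMeasure.
End Translation.

Section Restriction.
Variables (D : set euclid) (mD : measurable D).

Lemma restrict_integer (mu : configuration) (A : set euclid) :
  measurable A -> bounded_set (A : set 'rV[R]_N) ->
  exists n : nat, mrestr mu mD A = n%:R%:E.
Proof.
move=> mA bA; apply: cfg_integer; first exact: measurableI.
by move: bA => [M [Mr MA]]; exists M; split=> // x Mx y [Ay _]; exact: MA.
Qed.

Definition cfg_restrict (mu : configuration) : configuration :=
  @Configuration (mrestr mu mD) (@restrict_integer mu).

Lemma measurable_cfg_restrict : measurable_fun [set: configuration] cfg_restrict.
Proof.
apply: measurable_to_configuration => A mA.
by apply: measurable_cfg_eval; exact: measurableI.
Qed.

HB.instance Definition _ := isMeasurableFun.Build _ _ _ _
  cfg_restrict measurable_cfg_restrict.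

End Restriction.

(* The points of a configuration in a set D; a dummy value if they are
   infinitely many. *)
Definition points_in (mu : configuration) (D : set 'rV[R]_N) : {fset 'rV[R]_N} :=
  fset_set [set x | D x /\ cfg_measure mu [set x] != 0%E].

End Configurations.

Section PointProcess.
Variables (R : realType) (N : nat).
Context (d : measure_display) (Omega : measurableType d) (P : probability Omega R).
Implicit Types (Phi : {mfun Omega >-> configuration R N}).

Definition simple_process Phi : Prop :=
  {ae P, forall w, forall x : 'rV[R]_N, (cfg_measure (Phi w) [set x] <= 1)%E}.

Definition stationary Phi : Prop :=
  forall (a : 'rV[R]_N) (B : set (configuration R N)), measurable B ->
    distribution P Phi (cfg_shift a @^-1` B) = distribution P Phi B.

Definition all_moments_finite Phi : Prop :=
  forall (A : set (euclid R N)) (k : nat), measurable A ->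
    bounded_set (A : set 'rV[R]_N) -> (0 < k)%N ->
    (\int[P]_w (cfg_measure (Phi w) A ^+ k) < +oo)%E.

Definition box (L : R) : set 'rV[R]_N :=
  [set x | forall i, - (L / 2) <= x ord0 i < L / 2].

(* This is a plain set function, which suffices to integrate against it. *)
Definition scaled_intensity Phi (kappa : {fset 'rV[R]_N} -> \bar R)
    (F : fieldType) (q : nat) (L : R) (A : set (\bar R * \bar R)) : \bar R :=
  ((L ^- N)%:E * \int[P]_w xi kappa F q (points_in (Phi w) (box L)) A)%E.

End PointProcess.

Section Poisson.
Local Open Scope charge_scope.
Variables (R : realType) (N : nat).

(* The Lebesgue outer measure, which is the Lebesgue measure on Borel sets *)
Definition volume (A : set 'rV[R]_N) : \bar R :=
  ereal_inf [set (\sum_(k <oo) (\prod_i (ab.2 k ord0 i - ab.1 k ord0 i))%:E)%E |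
    ab in [set ab : (nat -> 'rV[R]_N) * (nat -> 'rV[R]_N) |
      (forall k i, ab.1 k ord0 i <= ab.2 k ord0 i) /\
      A `<=` \bigcup_k [set x | forall i, ab.1 k ord0 i <= x ord0 i < ab.2 k ord0 i]]].

Definition count_event (A : set (euclid R N)) (n : nat) : set (configuration R N) :=
  [set mu | cfg_measure mu A = n%:R%:E].

Definition poisson_law (lambda : R) (Pi : probability (configuration R N) R) : Prop :=
  (forall A : set (euclid R N), measurable A -> bounded_set (A : set 'rV[R]_N) ->
    forall n : nat, let m := lambda * fine (volume A) in
    Pi (count_event A n) = (expR (- m) * m ^+ n / n`!%:R)%:E) /\
  (forall (k : nat) (A : 'I_k -> set (euclid R N)) (n : 'I_k -> nat),
    (forall i, measurable (A i)) ->
    (forall i, bounded_set (A i : set 'rV[R]_N)) ->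
    trivIset setT A ->
    Pi (\bigcap_i count_event (A i) (n i)) = (\prod_i Pi (count_event (A i) (n i)))%E).

Definition restricted_density (D : set (euclid R N)) (mD : measurable D)
    (Theta Pi : probability (configuration R N) R) : configuration R N -> \bar R :=
  'd (charge_of_finite_measure (distribution Theta (cfg_restrict mD)))
  '/d (distribution Pi (cfg_restrict mD)).

End Poisson.

Section MeasuresOnDelta.
Variable R : realType.
Local Notation plane := (\bar R * \bar R)%type.

(* Radon measures on Delta are represented by Borel measures on [-oo, +oo]^2
   which are concentrated on Delta. *)
Definition radon_on_Delta (nu : {measure set plane -> \bar R}) : Prop :=
  nu (~` Delta (R := R)) = 0%E /\
  forall K : set plane, compact K -> K `<=` Delta (R := R) -> (nu K < +oo)%E.

(* Elements of C_c(Delta), extended by 0 outside Delta *)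
Definition Cc_Delta (f : plane -> R) : Prop :=
  {within Delta (R := R), continuous f} /\
  exists K : set plane, [/\ compact K, K `<=` Delta (R := R) &
    forall p, ~ K p -> f p = 0].

Definition vague_limit (nuL : R -> set plane -> \bar R)
    (nu : {measure set plane -> \bar R}) : Prop :=
  forall f, Cc_Delta f ->
    (fun L => \int[nuL L]_p (f p)%:E)%E @ +oo --> (\int[nu]_p (f p)%:E)%E.

Definition support_in_Delta (nu : {measure set plane -> \bar R}) : set plane :=
  [set p | Delta p /\
    forall U : set plane, open U -> U p -> (0 < nu (U `&` Delta (R := R)))%E].

Definition closure_in_Delta (A : set plane) : set plane :=
  closure A `&` Delta (R := R).

End MeasuresOnDelta.

(* Main.v *)
Require Import Defs.
From HB Require Import structures.
From mathcomp Require Import all_boot all_order all_algebra finmap.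
From mathcomp Require Import all_classical all_reals all_analysis.
From mathcomp Require Import measurable_realfun.
From mathcomp Require Import lra.

(** Both inclusions compare the vague limit with the integrals of a bump function [f]
    against the scaled intensities.

    If a neighbourhood of [p] contains no realizable point, no diagram charges it.
    The integrals of a bump function supported there all vanish, and so does their
    limit ([support_subset]).

    Conversely let [(b, d)] be a bar of a finite set [Xi0].  The homology at time [t]
    is the quotient of the cycles [Z t] by the boundaries among them, and a basis
    adapted to both of the increasing families [Z] and [B] decomposes it into
    intervals ([two_flags_adapted], [persistent_homology_decomposes]).  In every
    decomposition, the bars with birth in [ ]a1, a2] ] and death in [ ]c1, c2] ] are
    counted by the cycles at time [a2] that bound at time [c2], modulo those coming
    from time [a1] and those that bound at time [c1] ([rect_count_ge], [rect_has]).
    This has two consequences.  If the sides of the rectangle avoid the values of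
    [kappa] on [Xi0], then the Lipschitz property makes the complexes at the times
    [a1], [a2], [c1], [c2] insensitive to small perturbations of [Xi0].  If a
    configuration contains [n] perturbed translates of [Xi0], each of them so far from
    the other points that no edge joins them to these before the largest of these
    times, then their cycles are independent and the diagram has at least [n] points
    in the rectangle ([cluster_count], [copies_xi_ge]).

    Under the Poisson law, a cell of fixed size contains a perturbed copy of [Xi0] and
    no other point with positive probability ([poisson_copy_event]).  By the positivity
    of the density this also holds for the law of [Phi] ([density_event_gt0]), and by
    stationarity with the same probability in every cell.  A box of side [L] contains
    at least [(L / (2 l)) ^ N] disjoint cells of side [l], so that the scaled intensity
    of a neighbourhood of [(b, d)] is bounded below by a positive constant
    ([scaled_intensity_ge]), and so is the measure given to it by the limit
    ([closure_subset]). *)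

Set Implicit Arguments.
Unset Strict Implicit.
Unset Printing Implicit Defensive.

Import Order.TTheory GRing.Theory Num.Theory.
Import numFieldNormedType.Exports.

Local Open Scope classical_set_scope.
Local Open Scope ring_scope.

(** * Common adapted bases of two flags *)

Section Adapted.
Variables (F : fieldType) (V : vectType F).
Implicit Types (U W Z B : {vspace V}) (X Y : seq V).

(** [U] is spanned by the members of [X] that it contains.  Only the inclusion
    that can fail is required, which makes the notion monotone in [X]
    ([adapted_subseq]) and lets a basis be built by successive extensions. *)
Definition adapted X U := (U <= <<[seq x <- X | x \in U]>>)%VS.

Lemma adapted_subseq X Y U : {subset X <= Y} -> adapted X U -> adapted Y U.
Proof.
move=> sXY /subv_trans; apply; apply: sub_span => x.
by rewrite !mem_filter => /andP[-> /sXY].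
Qed.

Lemma adapted_add X U W : adapted X U -> adapted X W -> adapted X (U + W)%VS.
Proof.
move=> aU aW; rewrite /adapted subv_add; apply/andP; split.
  apply: (subv_trans aU); apply: sub_span => x; rewrite !mem_filter => /andP[xU ->].
  by rewrite (subvP (addvSl U W)).
apply: (subv_trans aW); apply: sub_span => x; rewrite !mem_filter => /andP[xU ->].
by rewrite (subvP (addvSr U W)).
Qed.

(** One step of the construction: the family is completed by a basis of a
    complement of [U :&: <<X>>] in [U]. *)
Lemma adapted_extend X U : free X -> adapted X (U :&: <<X>>)%VS ->
  exists Y, [/\ free Y, {subset X <= Y}, <<Y>>%VS = (<<X>> + U)%VS & adapted Y U].
Proof.
move=> fX aX; pose C := (U :\: <<X>>)%VS.
have CX : (<<X>> :&: C = 0)%VS by rewrite capvC; exact: capv_diff.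
have CU : (U = (U :&: <<X>>) + C)%VS by rewrite addvC addv_diff_cap.
have CsU : (C <= U)%VS by exact: diffvSl.
clearbody C; have XC : <<X ++ vbasis C>>%VS = (<<X>> + C)%VS.
  by rewrite span_cat (span_basis (vbasisP C)).
exists (X ++ vbasis C); split.
- rewrite /free size_cat size_tuple XC.
  by rewrite dimv_disjoint_sum// (eqP fX).
- by move=> x; rewrite mem_cat => ->.
- rewrite XC; apply/eqP; rewrite eqEsubv; apply/andP; split.
    by rewrite addvS.
  rewrite subv_add addvSl/= CU addvS//; exact: capvSr.
- rewrite CU; apply: adapted_add.
    by apply: adapted_subseq aX => x; rewrite mem_cat => ->.
  rewrite /adapted filter_cat span_cat; apply: subv_trans (addvSr _ _).
  rewrite -{1}(span_basis (vbasisP C)); apply: sub_span => x xC.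
  by rewrite mem_filter xC (vbasis_mem xC).
Qed.

(** The traces on [B] of the flag [Zs] are added from the smallest to the largest.
    The part of [Z :&: B] already spanned is, by the modular law, the sum of
    [Z :&: <<X>>] and of the previous trace, and both are adapted. *)
Lemma adapted_row X Zs B : free X -> (<<X>> <= B)%VS ->
  sorted (fun U W => (U <= W)%VS) Zs ->
  (forall Z, Z \in Zs -> adapted X (Z :&: <<X>>)%VS) ->
  exists Y, [/\ free Y, {subset X <= Y},
    <<Y>>%VS = (<<X>> + (last 0%VS Zs :&: B))%VS &
    forall Z, Z \in Zs -> adapted Y (Z :&: B)%VS].
Proof.
move=> fX XB; elim/last_ind: Zs => [|Zs Z IH] sZ aZ.
  by exists X; split=> //=; rewrite cap0v addv0.
have sZ' : sorted (fun U W => (U <= W)%VS) Zs.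
  by move: sZ; rewrite -cats1 => /cat_sorted2[].
have [|Y [fY sY eY aY]] := IH sZ'.
  by move=> W WZs; apply: aZ; rewrite mem_rcons inE WZs orbT.
have lZ : (last 0 Zs <= Z)%VS.
  case: Zs sZ {IH aZ sZ' eY aY} => [|W Zs] /=; first by rewrite sub0v.
  by rewrite rcons_path => /andP[].
have aL : adapted Y (last 0 Zs :&: B)%VS.
  case: Zs {sZ lZ IH aZ sZ' eY} aY => [|W Zs] aY /=; last exact/aY/mem_last.
  by rewrite cap0v /adapted sub0v.
have [|Y' [fY' sY' eY' aY']] := @adapted_extend Y (Z :&: B)%VS fY.
  have -> : (Z :&: B :&: <<Y>> = (Z :&: <<X>>) + (last 0 Zs :&: B))%VS.
    rewrite eY [RHS]addvC capvC [X in (X :&: _)%VS]addvC -vspace_modl ?capvS//.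
    by congr (_ + _)%VS; rewrite capvC -capvA (capv_idPr XB).
  apply: adapted_add aL; apply: adapted_subseq sY (aZ Z _).
  by rewrite mem_rcons mem_head.
exists Y'; split=> //.
- by move=> x /sY/sY'.
- rewrite eY' eY last_rcons -addvA; congr (_ + _)%VS.
  by apply/addv_idPr; rewrite capvS.
- move=> W; rewrite mem_rcons inE => /orP[/eqP->//|WZs].
  exact: adapted_subseq sY' (aY _ WZs).
Qed.

(** Bruhat decomposition: two flags have a common adapted basis.  The subspaces of
    [Bs], followed by the whole space, are filled one after the other, each of
    them along the flag [Zs]. *)
Lemma two_flags_adapted Zs Bs :
  sorted (fun U W => (U <= W)%VS) Zs -> sorted (fun U W => (U <= W)%VS) Bs ->
  exists X, [/\ free X, <<X>>%VS = fullv,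
    forall Z, Z \in Zs -> adapted X Z & forall B, B \in Bs -> adapted X B].
Proof.
move=> sZ sB.
suff IH : exists X, [/\ free X, <<X>>%VS = last 0%VS (rcons Bs fullv),
    forall Z, Z \in rcons Zs fullv -> adapted X (Z :&: <<X>>)%VS &
    forall B, B \in Bs -> adapted X B].
  have [X [fX eX aZ aB]] := IH; exists X; split=> //; first by rewrite eX last_rcons.
  move=> Z ZZs; have := aZ Z; rewrite mem_rcons inE ZZs orbT eX last_rcons capvf.
  exact.
have sub_full (s : seq {vspace V}) : sorted (fun U W => (U <= W)%VS) s ->
    sorted (fun U W => (U <= W)%VS) (rcons s fullv).
  by case: s => //= U s; rewrite rcons_path subvf andbT.
suff : forall Bs', sorted (fun U W => (U <= W)%VS) Bs' ->
  exists X, [/\ free X, <<X>>%VS = last 0%VS Bs',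
    forall Z, Z \in rcons Zs fullv -> adapted X (Z :&: <<X>>)%VS &
    forall B, B \in Bs' -> adapted X B].
  move=> /(_ _ (sub_full _ sB))[X [fX eX aZ aB]]; exists X; split=> // B BBs.
  by apply: aB; rewrite mem_rcons inE BBs orbT.
elim/last_ind => [|Bs' B IH] sB'.
  exists [::]; rewrite nil_free span_nil; split=> // Z _.
  by rewrite capv0 /adapted sub0v.
have [|X [fX eX aZ aB]] := IH.
  by move: sB'; rewrite -cats1 => /cat_sorted2[].
have XB : (<<X>> <= B)%VS.
  rewrite eX; case: Bs' sB' {IH eX aB} => [|W Bs'] /=; first by rewrite sub0v.
  by rewrite rcons_path => /andP[].
have [Y [fY sY eY aY]] := adapted_row fX XB (sub_full _ sZ) aZ.
have {}eY : <<Y>>%VS = B by rewrite eY last_rcons capfv; apply/addv_idPr.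
exists Y; split=> //; rewrite ?last_rcons ?eY//.
move=> W; rewrite mem_rcons inE => /orP[/eqP->|WB].
  by have := aY fullv; rewrite mem_rcons mem_head capfv; exact.
exact: adapted_subseq sY (aB _ WB).
Qed.

End Adapted.

(** * Homology classes *)

Section Coordinates.
Variables (F : fieldType) (V : vectType F) (X : seq V).
Hypothesis fX : free X.

Lemma coord_adapted (U : {vspace V}) (i : 'I_(size X)) v :
  adapted X U -> v \in U -> X`_i \notin U -> coord (in_tuple X) i v = 0.
Proof.
move=> aU vU XU.
have : (U <= lker (linfun (coord (in_tuple X) i : V -> F^o)))%VS.
  apply: (subv_trans aU); apply/span_subvP => x; rewrite mem_filter => /andP[xU xX].
  have xiX : (index x X < size X)%N by rewrite index_mem.
  have ex : (in_tuple X)`_(Ordinal xiX) = x by rewrite /= nth_index.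
  have e : coord (in_tuple X) i x = 0.
    rewrite -ex (@coord_free _ _ _ (in_tuple X) (Ordinal xiX) i fX); case: eqP => // ij.
    by move: XU; rewrite -ij ex xU.
  by rewrite memv_ker lfunE /= e.
by move=> /subvP/(_ _ vU); rewrite memv_ker lfunE /= => /eqP.
Qed.

End Coordinates.

(** A monotone property of the time that can only change at finitely many times
    holds exactly from some extended real threshold on. *)
Lemma right_cont_threshold (R : realType) (vals : seq R) (P : R -> bool) :
  (forall t, 0 <= t -> P t -> exists v, [/\ v \in vals, 0 <= v <= t & P v]) ->
  (forall s t, s <= t -> P s -> P t) ->
  exists b : \bar R, (0 <= b)%E /\ forall t, 0 <= t -> P t = (b <= t%:E)%E.
Proof.
move=> Pv Pm; pose s := sort <=%R [seq v <- vals | (0 <= v) && P v].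
have ss : sorted <=%R s by apply: sort_sorted; exact: le_total.
have sP v : v \in s = [&& 0 <= v, P v & v \in vals] by rewrite mem_sort mem_filter andbA.
case: s ss sP => [|v s] ss sP.
  exists +oo%E; split; first exact: leey.
  move=> t t0; rewrite leye_eq /=; apply/negP => /(Pv _ t0)[v [vv /andP[v0 _] Pvv]].
  by move: (sP v); rewrite v0 Pvv vv.
have : v \in v :: s by rewrite mem_head.
rewrite sP => /and3P[v0 Pvv _].
exists v%:E; rewrite lee_fin; split=> // t t0; rewrite lee_fin.
apply/idP/idP => [/(Pv _ t0)[w [wv /andP[w0 wt] Pw]]|vt]; last exact: Pm Pvv.
have : w \in v :: s by rewrite sP w0 Pw wv.
rewrite inE => /orP[/eqP <-//|ws]; apply: le_trans wt.
move: ss => /=; rewrite (path_sortedE le_trans) => /andP[/allP + _]; exact.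
Qed.

Section HomologyClasses.
Variables (F : fieldType) (V : finType) (q : nat).
Implicit Types (K L : {set {set V}}).

Definition hclass K (z : subvs_of (cycles F q K)) : homology F q K :=
  quotv_class _ z.

Lemma hclass_surj K (h : homology F q K) : exists z, h = hclass z.
Proof. by exists (quotv_repr h); rewrite /hclass quotv_reprK. Qed.

Lemma hclass_is_linear K : linear (@hclass K).
Proof. exact: quotv_class_is_linear. Qed.

HB.instance Definition _ K :=
  GRing.isLinear.Build F _ _ *:%R (@hclass K) (@hclass_is_linear K).

Lemma hclass_eq0 K (z : subvs_of (cycles F q K)) :
  (hclass z = 0) <-> (vsval z \in boundaries F q K).
Proof.
have -> : (0 : homology F q K) = hclass 0 by rewrite linear0.
split=> [/quotv_classP|]; rewrite ?subr0 -?memv_preim ?lfunE//.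
by move=> zB; apply/quotv_classP; rewrite subr0 -memv_preim lfunE.
Qed.

Lemma hclass_map K L (KL : K \subset L) z :
  homology_map F q KL (hclass z) = hclass (cycle_incl L z).
Proof. exact: quotv_map_class. Qed.

Section Descent.
Variables (K : {set {set V}}) (W : lmodType F) (l : {linear chain F V -> W}).
Hypothesis lB : forall z, z \in cycles F q K -> z \in boundaries F q K -> l z = 0.

(** The map induced on homology by a linear map on chains which kills the
    boundaries. *)
Definition descent of (forall z, z \in cycles F q K -> z \in boundaries F q K -> l z = 0)
  := fun h : homology F q K => l (vsval (quotv_repr h)).

Lemma descent_hclass z : descent lB (hclass z) = l (vsval z).
Proof.
apply/eqP; rewrite -subr_eq0 -linearB; apply/eqP/lB; rewrite -linearB ?subvsP//.
apply/hclass_eq0; rewrite linearB /= /hclass quotv_reprK subrr.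
by [].
Qed.

Lemma descent_is_linear : linear (descent lB).
Proof.
move=> a h k; have [x ->] := hclass_surj h; have [y ->] := hclass_surj k.
by rewrite -linearP !descent_hclass !linearP.
Qed.

HB.instance Definition _ :=
  GRing.isLinear.Build F (homology F q K) W *:%R (descent lB) descent_is_linear.

End Descent.
End HomologyClasses.

(** * Interval decomposition of persistent homology *)

Lemma cyclesS (F : fieldType) (V : finType) q (K L : {set {set V}}) :
  K \subset L -> (cycles F q K <= cycles F q L)%VS.
Proof. by move=> KL; rewrite capvS ?chainsS. Qed.

Lemma boundariesS (F : fieldType) (V : finType) q (K L : {set {set V}}) :
  K \subset L -> (boundaries F q K <= boundaries F q L)%VS.
Proof. by move=> KL; apply/limgS/chainsS. Qed.

Lemma chains_set0 (F : fieldType) (V : finType) q :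
  chains F q (finset.set0 : {set {set V}}) = 0%VS.
Proof. by rewrite /chains enum_set0 span_nil. Qed.

(** The fibre of an interval module is [F^1] or [F^0], according to a boolean.  The
    sum of the entries identifies [F^1] with [F] and sends [F^0] to 0, so that
    coordinates at different times become comparable elements of [F]. *)
Section RowBool.
Variables (F : fieldType) (b : bool).
Implicit Type v : 'rV[F]_b.

Definition rsum v := \sum_j v ord0 j.

Lemma rsum_entry v (j : 'I_b) : v ord0 j = rsum v.
Proof.
rewrite /rsum; case: b v j => [v j|v [//]].
by rewrite big_ord1; congr (v _ _); exact: ord1.
Qed.

Lemma rsum_false v : ~~ b -> rsum v = 0.
Proof. by rewrite /rsum; case: b v => // v _; rewrite big_ord0. Qed.

End RowBool.

Section Decomposition.
Variables (R : realType) (N : nat) (kappa : {fset 'rV[R]_N} -> \bar R).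
Hypothesis kappa0 : forall sigma, sigma != fset0 -> (0 <= kappa sigma)%E.
Variables (F : fieldType) (q : nat) (Xi : {fset 'rV[R]_N}).

Local Notation K := (cplx kappa Xi).
Local Notation Z t := (cycles F q (K t)).
Local Notation B t := (boundaries F q (K t)).
Local Notation face s := [fset val x | x in s]%fset.

Lemma face_neq0 (s : {set Xi}) : s != finset.set0 -> face s != fset0.
Proof.
case/finset.set0Pn=> x xs; apply/fset0Pn; exists (val x).
by apply/imfsetP; exists x.
Qed.

Lemma cplx_lt0 t : t < 0 -> K t = finset.set0.
Proof.
move=> t0; apply/setP => s; rewrite !inE; apply/negP => /andP[s0 st].
have := le_trans (kappa0 (face_neq0 s0)) st.
by rewrite lee_fin leNgt t0.
Qed.

(** The filtration only changes at values of [kappa], so that every complex of the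
    filtration is the one at the largest value of [kappa] below the given time. *)
Lemma cplx_finite : exists2 vals : seq R, sorted <=%R vals &
  forall t, K t = finset.set0 \/ exists v, [/\ v \in vals, 0 <= v <= t & K t = K v].
Proof.
exists (sort <=%R [seq fine (kappa (face s)) | s : {set Xi}]).
  by apply: sort_sorted; exact: le_total.
move=> t; have [->|[s0 s0K]] := set_0Vmem (K t); [by left|right].
case: (arg_maxP (fun s : {set Xi} => fine (kappa (face s))) s0K) => s sK smax.
have kfin s' : s' \in K t -> (kappa (face s') = (fine (kappa (face s')))%:E) /\
    0 <= fine (kappa (face s')) <= t.
  rewrite inE => /andP[/face_neq0/kappa0]; case: (kappa _) => [r||] //=.
  by rewrite !lee_fin => -> ->.
exists (fine (kappa (face s))); split.
- by rewrite mem_sort; apply/mapP; exists s; rewrite // mem_enum.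
- by case: (kfin _ sK).
- apply/setP => s'; apply/idP/idP => s'K.
    have [+ _] := kfin _ s'K; rewrite !inE => ->.
    move: (s'K) (smax _ s'K); rewrite inE => /andP[-> _] /=.
    by rewrite lee_fin.
  case: (kfin _ sK) => _ /andP[_ st].
  by move: s'K; apply/fintype.subsetP/cplxS.
Qed.

Lemma cycle_threshold (U : R -> {vspace chain F Xi}) (e : chain F Xi) : e != 0 ->
  (forall s t, s <= t -> (U s <= U t)%VS) ->
  (forall t, K t = finset.set0 -> U t = 0%VS) ->
  (forall s t, K s = K t -> U s = U t) ->
  exists b : \bar R, (0 <= b)%E /\ forall t, 0 <= t -> (e \in U t) = (b <= t%:E)%E.
Proof.
move=> e0 Um U0 UK; have [vals _ valsP] := cplx_finite.
apply: (@right_cont_threshold _ vals) => [t t0 et|s t st]; last exact/subvP/Um.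
have [/U0 Ut|[v [vv vt Ktv]]] := valsP t; first by move: et; rewrite Ut memv0 (negPf e0).
by exists v; split=> //; rewrite -(UK _ _ Ktv).
Qed.

(** Existence of the decomposition.  The homology at time [t] is the quotient of
    [Z t] by [Z t :&: B t], where [Z] and [B] are two increasing families of
    subspaces of one space of chains.  In a basis adapted to both families, a basis
    vector [e] is alive between its entrance into [Z] and its entrance into [B]; the
    components of the isomorphism are the coordinates in this basis. *)
Lemma persistent_homology_decomposes :
  exists ds, decomposes (persistent_homology kappa F q Xi) ds.
Proof.
have [vals vs valsP] := cplx_finite.
have Zm s t : s <= t -> (Z s <= Z t)%VS by move=> st; exact/cyclesS/cplxS.
have Bm s t : s <= t -> (B s <= B t)%VS by move=> st; exact/boundariesS/cplxS.
have Z0 t : K t = finset.set0 -> Z t = 0%VS.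
  by move=> ->; rewrite /cycles chains_set0 cap0v.
have B0 t : K t = finset.set0 -> B t = 0%VS.
  by move=> ->; rewrite /boundaries chains_set0 limg0.
have [X [fX sX aZ aB]] : exists X : seq (chain F Xi), [/\ free X, <<X>>%VS = fullv,
    forall t, adapted X (Z t) & forall t, adapted X (B t)].
  have [||X [fX sX aZ aB]] := @two_flags_adapted _ _ [seq Z t | t <- vals] [seq B t | t <- vals].
  - by rewrite sorted_map; apply: sub_sorted vs => s t; exact: Zm.
  - by rewrite sorted_map; apply: sub_sorted vs => s t; exact: Bm.
  exists X; split=> // t.
    have [/Z0 ->|[v [vv _ Kv]]] := valsP t; first by rewrite /adapted sub0v.
    by rewrite Kv; apply/aZ/map_f.
  have [/B0 ->|[v [vv _ Kv]]] := valsP t; first by rewrite /adapted sub0v.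
  by rewrite Kv; apply/aB/map_f.
(* [b k] and [d k] are the entrance times of the k-th basis vector into Z and B. *)
pose e (k : 'I_(size X)) := X`_k.
have e0 k : e k != 0 by apply: (free_not0 fX); rewrite mem_nth.
have /(@boolp.choice _ _)[b bP] : forall k, exists b : \bar R, (0 <= b)%E /\
    forall t, 0 <= t -> (e k \in Z t) = (b <= t%:E)%E.
  move=> k; apply: (@cycle_threshold (fun t => Z t) _ (e0 k)) => //.
  by move=> s t ->.
have /(@boolp.choice _ _)[d dP] : forall k, exists d : \bar R, (0 <= d)%E /\
    forall t, 0 <= t -> (e k \in B t) = (d <= t%:E)%E.
  move=> k; apply: (@cycle_threshold (fun t => B t) _ (e0 k)) => //.
  by move=> s t ->.
pose I := [seq k <- enum 'I_(size X) | (b k < d k)%E].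
pose ds := [seq (b k, d k) | k <- I].
have szI : size ds = size I by rewrite size_map.
pose ix (i : 'I_(size ds)) : 'I_(size X) := tnth (in_tuple I) (cast_ord szI i).
have dsE i : tnth (in_tuple ds) i = (b (ix i), d (ix i)).
  have k0 := ix i; rewrite (tnth_nth (+oo, +oo)%E) /= /ds (nth_map k0); last by rewrite -szI.
  by rewrite /ix (tnth_nth k0).
have aliveE i t : 0 <= t ->
    alive (tnth (in_tuple ds) i) t = (e (ix i) \in Z t) && (e (ix i) \notin B t).
  by move=> t0; rewrite dsE /alive /= -(bP _).2// ltNge -(dP _).2.
pose l t i : chain F Xi -> interval_module F (tnth (in_tuple ds) i) t :=
  fun z => \row_j coord (in_tuple X) (ix i) z.
have l_lin t i : linear (l t i).
  by move=> a x y; apply/rowP => j; rewrite !mxE linearP.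
pose lL t i : {linear chain F Xi -> interval_module F (tnth (in_tuple ds) i) t} :=
  HB.pack (l t i) (GRing.isLinear.Build _ _ _ _ (l t i) (l_lin t i)).
have lB t i : 0 <= t -> forall z, z \in cycles F q (K t) -> z \in boundaries F q (K t) -> lL t i z = 0.
  move=> t0 z zZ zB; apply/rowP => j; rewrite !mxE.
  apply: coord_adapted (aB t) zB _ => //.
  by move: (j); case: (alive _ t) (aliveE i t t0) => [/esym/andP[]|_ []].
have [phi phiE] : exists phi : forall (t : R) (i : 'I_(size ds)),
      {linear persistent_homology kappa F q Xi t -> interval_module F (tnth (in_tuple ds) i) t},
    forall t i, 0 <= t -> forall z, phi t i (hclass z) = l t i (vsval z).
  exists (fun t i => match pselect (0 <= t) with
    | left t0 => descent (lB t i t0) : {linear _ -> _}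
    | right _ => \0 : {linear _ -> _} end) => t i t0 z.
  by case: pselect => // t0'; exact: descent_hclass.
exists ds; split.
  move=> p /mapP[k]; rewrite mem_filter => /andP[bd _] ->.
  by split => //=; exact: (bP k).1.
exists phi; split => [t t0|s t st i h s0].
  (* A cycle whose coordinates along the living basis vectors vanish is a
     combination of basis vectors that have already entered B. *)
  have inj h : (forall i, phi t i h = 0) -> h = 0.
    have [z ->] := hclass_surj h => zi; apply/hclass_eq0.
    have zX : vsval z \in <<in_tuple X>>%VS by rewrite sX memvf.
    rewrite (coord_span zX); apply: memv_suml => k _.
    have [ekB|ekB] := boolP (e k \in B t); first exact: memvZ.
    have [ekZ|ekZ] := boolP (e k \in Z t); last first.
      by rewrite (coord_adapted fX (aZ t) (subvsP z) ekZ) scale0r mem0v.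
    have kI : k \in I.
      rewrite mem_filter mem_enum andbT; move: ekB ekZ.
      by rewrite (bP k).2// (dP k).2// -ltNge => /[swap]; exact: le_lt_trans.
    have kI' : (index k I < size ds)%N by rewrite szI index_mem.
    have ixk : ix (Ordinal kI') = k.
      by rewrite /ix (tnth_nth k) /= nth_index.
    have := aliveE (Ordinal kI') t t0; rewrite ixk ekZ ekB /= => al.
    have j : 'I_(alive (tnth (in_tuple ds) (Ordinal kI')) t) by rewrite al; exact: ord0.
    have := zi (Ordinal kI'); rewrite phiE// => /rowP/(_ j).
    by rewrite !mxE ixk => ->; rewrite scale0r mem0v.
  pose g (v : forall i, interval_module F (tnth (in_tuple ds) i) t) : chain F Xi :=
    \sum_i rsum (v i : 'rV_(alive (tnth (in_tuple ds) i) t)) *: e (ix i).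
  have gZ v : g v \in Z t.
    apply: memv_suml => i _; have [al|/negP nal] := pselect (alive (tnth (in_tuple ds) i) t).
      by have /andP[eZ _] := etrans (esym (aliveE i t t0)) al; exact: memvZ.
    by rewrite rsum_false// scale0r mem0v.
  have ixI : injective ix.
    move=> i1 i2 /eqP; have k0 := ix i1; rewrite /ix !(tnth_nth k0) /=.
    have uI : uniq I by rewrite filter_uniq ?enum_uniq.
    have ltI (i : 'I_(size ds)) : (i < size I)%N by rewrite -szI.
    by rewrite (nth_uniq _ (ltI i1) (ltI i2) uI) => /eqP ij; apply: val_inj.
  have gK v i : l t i (g v) = v i.
    apply/rowP => j; rewrite mxE /g linear_sum (bigD1 i)//= big1 ?addr0; last first.
      move=> k ki; rewrite linearZ /= (@coord_free _ _ _ (in_tuple X))//.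
      by rewrite (inj_eq ixI) (negPf ki) mulr0.
    rewrite linearZ /= (@coord_free _ _ _ (in_tuple X))// eqxx mulr1.
    exact: esym (rsum_entry _ _).
  exists (fun v => hclass (vsproj (Z t) (g v))).
    move=> h; apply/eqP; rewrite -subr_eq0; apply/eqP/inj => i.
    by rewrite linearB /= phiE// vsprojK// gK subrr.
  move=> v; apply: functional_extensionality_dep => i.
  by rewrite phiE// vsprojK// gK.
have t0 : 0 <= t by exact: le_trans st.
have [z ->] := hclass_surj h.
rewrite /= hclass_map !phiE// cycle_inclK ?cplxS//.
have := aliveE i s s0; have := aliveE i t t0.
rewrite /l /mulmxr; move: (tnth _ i) (dsE i) => p pE.
have : alive p t -> ~~ alive p s -> e (ix i) \notin Z s.
  rewrite pE /alive /= (bP _).2// => /andP[_ td].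
  have -> : (s%:E < d (ix i))%E by apply: le_lt_trans td; rewrite lee_fin.
  by rewrite andbT.
case: (alive p t) => [|_ _ _]; last by apply/rowP => -[].
case: (alive p s) => [_ _ _|/(_ isT isT) eZ _ _].
  apply/rowP => j; rewrite !mxE big_ord1 !mxE !ord1 eqxx mulr1.
  by [].
apply/rowP => j; rewrite !mxE big_ord0.
exact: coord_adapted (aZ s) (subvsP z) eZ.
Qed.
End Decomposition.

(** * Bars in a rectangle *)

Lemma rsum_pid (F : fieldType) (b b' : bool) (v : 'rV[F]_b) :
  rsum (v *m (pid_mx 1 : 'M[F]_(b, b')) : 'rV[F]_b') = (b')%:R * rsum v.
Proof.
case: b' => /=; last by rewrite mul0r rsum_false.
rewrite mul1r -(@rsum_entry _ true _ ord0) mxE /rsum.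
by apply: eq_bigr => j _; rewrite mxE; case: b v j => v j; [rewrite !ord1 eqxx mulr1|case: j].
Qed.

Lemma rsum_const (F : fieldType) (b : bool) (a : F) :
  rsum (const_mx a : 'rV[F]_b) = b%:R * a.
Proof.
by rewrite /rsum; case: b; rewrite ?big_ord1 ?big_ord0 ?mxE ?mul1r ?mul0r.
Qed.

Lemma rsum_eq0 (F : fieldType) (b : bool) (v : 'rV[F]_b) : rsum v = 0 -> v = 0.
Proof. by move=> v0; apply/rowP => j; rewrite mxE rsum_entry. Qed.

Lemma rsum_is_linear (F : fieldType) (b : bool) (a : F) (v w : 'rV[F]_b) :
  rsum (a *: v + w) = a * rsum v + rsum w.
Proof.
by rewrite /rsum mulr_sumr -big_split; apply: eq_bigr => j _; rewrite !mxE.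
Qed.

(** The absence of an upper bound on the death, [c2 = None], lets infinite bars be
    counted in the same way as finite ones. *)
Definition in_rect (R : realType) (a1 a2 c1 : R) (c2 : option R) (p : \bar R * \bar R) :=
  [&& (a1%:E < p.1)%E, (p.1 <= a2%:E)%E, (c1%:E < p.2)%E &
    if c2 is Some c then (p.2 <= c%:E)%E else true].

(** The bars of the rectangle are the dimension of [rect_upper] modulo
    [rect_lower]: a class alive at [a2] and dead at [c2] belongs to the rectangle
    unless it was born before [a1] or is dead at [c1]. *)
Section RectSpaces.
Variables (R : realType) (F : fieldType) (V : finType) (q : nat).
Variable K : R -> {set {set V}}.
Variables (a1 a2 c1 : R) (c2 : option R).
Local Notation Z t := (cycles F q (K t)).
Local Notation B t := (boundaries F q (K t)).

Definition dying (c : option R) : {vspace chain F V} :=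
  if c is Some c then B c else fullv.

Definition rect_upper : {vspace chain F V} := (Z a2 :&: dying c2)%VS.

Definition rect_lower : {vspace chain F V} :=
  (Z a1 :&: dying c2 + Z a2 :&: B c1)%VS.

End RectSpaces.

(** The decomposition below is arbitrary: the diagram is defined by choice among
    all of them. *)
Section BarsInRectangle.
Variables (R : realType) (N : nat) (kappa : {fset 'rV[R]_N} -> \bar R).
Hypothesis kappa0 : forall sigma, sigma != fset0 -> (0 <= kappa sigma)%E.
Variables (F : fieldType) (q : nat) (Xi : {fset 'rV[R]_N}).
Local Notation K := (cplx kappa Xi).
Local Notation Z t := (cycles F q (K t)).
Local Notation B t := (boundaries F q (K t)).
Local Notation M := (persistent_homology kappa F q Xi).
Variables (a1 a2 c1 : R) (c2 : option R).
Hypotheses (a12 : a1 <= a2) (a20 : 0 <= a2) (ac : a2 < c1).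
Hypothesis (cc : if c2 is Some c then c1 <= c else true).
Variable ds : seq (\bar R * \bar R).
Hypothesis dsP : forall p, p \in ds -> Delta p.
Local Notation bar i := (tnth (in_tuple ds) i).
Variable phi : forall (t : R) (i : 'I_(size ds)),
  {linear M t -> interval_module F (bar i) t}.
Hypothesis phi_bij : forall t : R, 0 <= t -> bijective (fun (h : M t) i => phi t i h).
Hypothesis phi_nat : forall s t (st : s <= t) i (h : M s), 0 <= s ->
  phi t i (pm_map M st h) = pm_map (interval_module F (bar i)) st (phi s i h).

(** The coordinate along the i-th bar of the class of [z] at time [t]. *)
Let coef t i (z : chain F Xi) : F :=
  rsum (phi t i (hclass (vsproj (Z t) z)) : 'rV[F]_(alive (bar i) t)).

Let coef_lin t i a x y : coef t i (a *: x + y) = a * coef t i x + coef t i y.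
Proof. by rewrite /coef !linearP -rsum_is_linear. Qed.

Let coef_dead t i z : ~~ alive (bar i) t -> coef t i z = 0.
Proof. by move=> ?; rewrite /coef rsum_false. Qed.

Let coefZ s t i z : 0 <= s -> s <= t -> z \in Z s ->
  coef t i z = (alive (bar i) t)%:R * coef s i z.
Proof.
move=> s0 st zs; rewrite /coef.
have <- := rsum_pid (alive (bar i) t).
congr rsum; have /= <- := @phi_nat s t st i (hclass (vsproj (Z s) z)) s0.
congr (phi t i _); rewrite /= hclass_map; congr hclass.
apply: val_inj; rewrite /= -/(vsval _) cycle_inclK ?cplxS// !vsprojK//.
by apply: subvP zs; apply/cyclesS/cplxS.
Qed.

Let coef_B t z : 0 <= t -> z \in Z t ->
  (forall i, coef t i z = 0) <-> z \in B t.
Proof.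
move=> t0 zt; have -> : z = vsval (vsproj (Z t) z) by rewrite vsprojK.
split=> [z0|/hclass_eq0 zB i]; last first.
  rewrite /coef; have -> : vsproj (Z t) (vsval (vsproj (Z t) z)) = vsproj (Z t) z.
    by rewrite vsprojK.
  by rewrite zB linear0 /rsum big1// => j _; rewrite mxE.
apply/hclass_eq0; have [g gK _] := phi_bij t0.
apply: (can_inj gK); apply: functional_extensionality_dep => i.
rewrite linear0; apply: (@rsum_eq0 F (alive (bar i) t)).
by have := z0 i; rewrite /coef vsprojK.
Qed.

Let coef_surj t (v : 'I_(size ds) -> F) : 0 <= t ->
  exists2 z, z \in Z t & forall i, coef t i z = (alive (bar i) t)%:R * v i.
Proof.
move=> t0; have [g _ gK] := phi_bij t0.
pose w i : interval_module F (bar i) t := (const_mx (v i) : 'rV[F]_(alive (bar i) t)).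
have [z gz] := hclass_surj (g w).
exists (vsval z) => [|i]; first exact: subvsP.
rewrite /coef; have -> : vsproj (Z t) (vsval z) = z by apply: val_inj; rewrite /= vsprojK ?subvsP.
have /(congr1 (fun f => f i)) /= := gK w; rewrite gz => ->.
exact: rsum_const.
Qed.

Let Z_lt0 t : t < 0 -> Z t = 0%VS.
Proof. by move=> t0; rewrite /cycles cplx_lt0// chains_set0 cap0v. Qed.

Let Delta_bar i : Delta (bar i).
Proof. by apply: dsP; exact: mem_tnth. Qed.

Let c10 : 0 <= c1. Proof. exact: le_trans a20 (ltW ac). Qed.

Let aliveW s t (p : \bar R * \bar R) : s <= t -> (p.1 <= s%:E)%E -> (t%:E < p.2)%E -> alive p s /\ alive p t.
Proof.
move=> st ps tp; split; apply/andP; split=> //.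
  by apply: le_lt_trans tp; rewrite lee_fin.
by apply: le_trans ps _; rewrite lee_fin.
Qed.

Let coef_late i z : z \in rect_upper F q K a2 c2 ->
  (if c2 is Some c then (c%:E < (bar i).2)%E else false) -> coef a2 i z = 0.
Proof.
rewrite memv_cap => /andP[zZ]; case: c2 cc => // c cc' zB cd.
have [al|] := boolP (alive (bar i) a2); last exact: coef_dead.
have a2c : a2 <= c by rewrite (le_trans (ltW ac)).
have [_ alc] := aliveW a2c (andP al).1 cd.
have c0 : 0 <= c by exact: le_trans a2c.
have zZc : z \in Z c by apply: subvP zZ; exact/cyclesS/cplxS.
have := @coefZ a2 c i z a20 a2c zZ; rewrite alc mul1r => <-.
by move: i {al cd alc}; apply/coef_B.
Qed.

(** A cycle whose coordinates along the bars of the rectangle vanish splits into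
    the part carried by the bars born before [a1], which lifts to time [a1], and a
    remainder carried by the bars dead at [c1]. *)
Lemma rect_lowerP z : z \in rect_upper F q K a2 c2 ->
  (forall i, in_rect a1 a2 c1 c2 (bar i) -> coef a2 i z = 0) ->
  z \in rect_lower F q K a1 a2 c1 c2.
Proof.
move=> zU zI; have zZ : z \in Z a2 by case: (memv_capP zU).
have key z1 : z1 \in Z a1 -> z1 \in dying F q K c2 ->
    (forall i, alive (bar i) c1 -> alive (bar i) a2 ->
      (a1%:E < (bar i).1)%E -> coef a2 i z1 = 0) ->
    (forall i, alive (bar i) c1 -> alive (bar i) a2 ->
      ((bar i).1 <= a1%:E)%E -> coef a2 i z1 = coef a2 i z) ->
    z \in rect_lower F q K a1 a2 c1 c2.
  move=> z1Z z1D z1a z1b.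
  have z1Z2 : z1 \in Z a2 by apply: subvP z1Z; exact/cyclesS/cplxS.
  have zz1Z2 : z - z1 \in Z a2 by rewrite rpredB.
  rewrite -(subrKC z1 z); apply: memv_add; rewrite memv_cap; first by rewrite z1Z.
  rewrite zz1Z2 /=; apply/coef_B => //.
    by apply: subvP zz1Z2; apply/cyclesS/cplxS/ltW.
  move=> i; rewrite (@coefZ a2)// ?(ltW ac)//.
  have [alc|_] := boolP (alive (bar i) c1); last by rewrite mul0r.
  rewrite -scaleN1r addrC coef_lin mulN1r mul1r.
  have [al2|nal2] := boolP (alive (bar i) a2); last by rewrite !coef_dead// oppr0 addr0.
  have [ba|ab] := leP (bar i).1 a1%:E; first by rewrite z1b// addNr.
  rewrite z1a// oppr0 add0r.
  case: (boolP (in_rect a1 a2 c1 c2 (bar i))) => [/zI//|].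
  case/andP: al2 => al2 _; case/andP: alc => _ alc.
  rewrite /in_rect ab al2 alc /= => nc; apply: coef_late zU _.
  by case: c2 nc => // c; rewrite -ltNge.
(* Before time 0 nothing is known of the decomposition, but no bar is born. *)
have [a10|a10] := ltP a1 0.
  apply: (key 0); rewrite ?mem0v// => i _ _ ba.
    have := coef_lin a2 i (-1) 0 0; rewrite scaler0 addr0 => ->.
    by rewrite mulN1r addNr.
  have [b0 _] := Delta_bar i; have := le_trans b0 ba.
  by rewrite lee_fin leNgt a10.
have [z1 z1Z z1E] := coef_surj (fun i => coef a2 i z) a10.
apply: (key z1) => // [|i alc al2 ab|i alc al2 ba].
- have := fun i => @coef_late i z zU; case: c2 cc => [c cc' late|_ _]; last exact: memvf.
  have a2c : a2 <= c by rewrite (le_trans (ltW ac)).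
  have a1c : a1 <= c by exact: le_trans a2c.
  apply/coef_B => [||i]; first exact: le_trans a1c.
    by apply: subvP z1Z; exact/cyclesS/cplxS.
  rewrite (@coefZ a1)// z1E.
  have [alc|_] := boolP (alive (bar i) c); last by rewrite mul0r.
  by rewrite late ?mulr0//; case/andP: alc.
- rewrite (@coefZ a1)// z1E; case: (boolP (alive (bar i) a1)); last by rewrite mul0r mulr0.
  by rewrite /alive leNgt ab.
- rewrite (@coefZ a1)// z1E al2 mul1r.
  have [-> _] := @aliveW a1 a2 (bar i) a12 ba (andP al2).2.
  by rewrite mul1r.
Qed.

Lemma count_in_rect : count (in_rect a1 a2 c1 c2) ds =
  #|[set i : 'I_(size ds) | in_rect a1 a2 c1 c2 (bar i)]%SET|.
Proof.
rewrite -sum1_count cardsE -sum1_card big_tnth.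
by apply: eq_bigl.
Qed.

(** The matrix of the coordinates of the [z k] along the bars of the rectangle has
    independent rows, so that it has at least as many columns as rows. *)
Lemma rect_count_ge n (z : 'I_n -> chain F Xi) :
  (forall k, z k \in rect_upper F q K a2 c2) ->
  (forall u : 'I_n -> F, \sum_k u k *: z k \in rect_lower F q K a1 a2 c1 c2 ->
    forall k, u k = 0) ->
  (n <= count (in_rect a1 a2 c1 c2) ds)%N.
Proof.
move=> zU zf; rewrite count_in_rect leqNgt; apply/negP.
set I := [set i | _]%SET => In.
pose A : 'M[F]_(n, #|I|) := \matrix_(k, i) coef a2 (enum_val i) (z k).
have : kermx A != 0.
  by rewrite kermx_eq0 /row_free neq_ltn (leq_ltn_trans (rank_leq_col A)).
case/rowV0Pn => u /sub_kermxP uA /negP; apply.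
have coef_sum i : coef a2 i (\sum_k u ord0 k *: z k) = \sum_k u ord0 k * coef a2 i (z k).
  elim/big_rec2: _ => [|k x y _ <-]; last by rewrite coef_lin.
  have := coef_lin a2 i (-1) 0 0; rewrite scaler0 addr0 => ->.
  by rewrite mulN1r addNr.
have : \sum_k u ord0 k *: z k \in rect_lower F q K a1 a2 c1 c2.
  apply: rect_lowerP => [|i iI]; first by apply: memv_suml => k _; exact: memvZ.
  have iI' : i \in I by rewrite inE.
  move/rowP/(_ (enum_rank_in iI' i)): uA; rewrite !mxE coef_sum => uA.
  rewrite -[RHS]uA; apply: eq_bigr => k _.
  by rewrite mxE enum_rankK_in.
by move/zf => u0; apply/eqP/rowP => k; rewrite mxE u0.
Qed.

(** Conversely, a bar of the rectangle yields a cycle: the generator of this bar at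
    time [a2]. *)
Lemma rect_has : has (in_rect a1 a2 c1 c2) ds ->
  exists2 z, z \in rect_upper F q K a2 c2 & z \notin rect_lower F q K a1 a2 c1 c2.
Proof.
case/hasP => p /seq_tnthP[i ->] /and4P[ab ba cd dc].
have [ala2 alc1] := aliveW (ltW ac) ba cd.
have a1c1 : a1 <= c1 by exact: le_trans (ltW ac).
have [z zZ zE] := coef_surj (fun j => (j == i)%:R) a20.
exists z.
  rewrite memv_cap zZ /=; case: c2 cc dc => [c cc' dc|_ _]; last exact: memvf.
  have a2c : a2 <= c by rewrite (le_trans (ltW ac)).
  apply/coef_B => [||j]; first exact: le_trans a2c.
    by apply: subvP zZ; exact/cyclesS/cplxS.
  rewrite (@coefZ a2)// zE; have [->|ji] := eqVneq j i; last by rewrite !mulr0.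
  by rewrite {1}/alive ltNge dc andbF mul0r.
apply/negP => /memv_addP[z1 /memv_capP[z1Z _] [z2 /memv_capP[z2Z z2B] zz]].
have z1Z2 : z1 \in Z a2 by apply: subvP z1Z; exact/cyclesS/cplxS.
have Z12 : (Z a2 <= Z c1)%VS by exact/cyclesS/cplxS/ltW.
have : coef c1 i z = 1 by rewrite (@coefZ a2)// ?(ltW ac)// zE ala2 alc1 eqxx !mul1r.
have -> : coef c1 i z = coef c1 i z1 + coef c1 i z2.
  by have := coef_lin c1 i 1 z1 z2; rewrite scale1r mul1r -zz.
have -> : coef c1 i z2 = 0.
  by move: (i); apply/coef_B => //; exact: (subvP Z12).
rewrite addr0; have [a10|a10] := ltP a1 0.
  move: z1Z; rewrite (Z_lt0 a10) memv0 => /eqP ->.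
  rewrite (coef_B c10 (mem0v _)).2 ?mem0v// => /eqP.
  by rewrite eq_sym oner_eq0.
rewrite (@coefZ a1)// (@coef_dead a1); last by rewrite /alive leNgt ab.
by rewrite mulr0 => /eqP; rewrite eq_sym oner_eq0.
Qed.

End BarsInRectangle.

(** * Chain maps of injections *)

Section Chains.
Variables (F : fieldType) (V : finType).
Implicit Types (s : {set V}) (c : chain F V) (K : {set {set V}}).

Lemma chain_sum c : c = \sum_s (c s : F) *: simplex_chain F s.
Proof.
apply/ffunP => s; rewrite sum_ffunE (bigD1 s)//= big1 ?addr0 => [|t ts].
  by rewrite !ffunE eqxx; exact/esym/mulr1.
by rewrite !ffunE eq_sym (negPf ts); exact: mulr0.
Qed.

Lemma linear_chain_eq (W : lmodType F) (f h : {linear chain F V -> W}) c :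
  (forall s, c s != 0 -> f (simplex_chain F s) = h (simplex_chain F s)) ->
  f c = h c.
Proof.
move=> fh; rewrite (chain_sum c) !linear_sum; apply: eq_bigr => s _.
have [->|cs] := eqVneq (c s) 0; first by rewrite !scale0r !linear0.
by rewrite !linearZ /= fh.
Qed.

Lemma chainsP q K c :
  c \in chains F q K <-> (forall s, c s != 0 -> s \in K /\ #|s| = q.+1).
Proof.
split=> [|cK]; last first.
  rewrite (chain_sum c); apply: memv_suml => s _.
  have [->|/cK[sK sq]] := eqVneq (c s) 0; first by rewrite scale0r mem0v.
  apply/memvZ/memv_span; apply: map_f.
  by rewrite mem_filter mem_enum sq eqxx.
move=> cK s; apply: contraPP => sK; apply/negP; rewrite negbK; apply/eqP.
pose X := [seq simplex_chain F s | s <- enum K & #|s| == q.+1].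
have := @coord_span _ _ _ (in_tuple X) c cK => ->.
rewrite sum_ffunE big1// => i _; rewrite ffunE.
have : (in_tuple X)`_i \in X by rewrite mem_nth.
case/mapP => t; rewrite mem_filter mem_enum => /andP[/eqP tq tK] ->.
rewrite ffunE; have [st|_] := eqVneq s t; last exact: mulr0.
by case: sK; rewrite st.
Qed.

Lemma boundary_simplex s : boundary F V (simplex_chain F s) = simplex_boundary F s.
Proof.
rewrite lfunE /= /boundary_fun (bigD1 s)//= big1 ?addr0 => [|t ts].
  by rewrite ffunE eqxx scale1r.
by rewrite ffunE (negPf ts) scale0r.
Qed.

End Chains.

Section ChainMap.
Variables (F : fieldType) (V V' : finType) (g : V -> V') (g_inj : injective g).
Implicit Types (s : {set V}).

(** Simplices are oriented by the enumerations of the vertices, which an injection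
    [g] need not preserve.  The induced chain map therefore carries the sign of the
    permutation that [g] induces on each simplex. *)
Definition inversions s : {set V * V} := [set p in finset.setX s s |
  (enum_rank p.1 < enum_rank p.2)%N && (enum_rank (g p.2) < enum_rank (g p.1))%N]%SET.

Definition orientation s : F := (-1) ^+ #|inversions s|.

Lemma orientation_sqr s : orientation s * orientation s = 1.
Proof. by rewrite -expr2 /orientation sqrr_sign. Qed.

(** Removing [v] from [s] removes the inversions between [v] and another vertex
    [w].  These are the [w] that lie before [v] on exactly one side of [g], and
    modulo 2 their number is the sum of the positions of [v] and of [g v]. *)
Lemma orientationD1 s v : v \in s ->
  (-1) ^+ vertex_pos (g @: s)%SET (g v) * orientation (s :\ v)%SET =
  orientation s * (-1) ^+ vertex_pos s v :> F.
Proof.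
move=> vs.
have rg w : ((enum_rank (g w) : nat) == enum_rank (g v)) = (w == v).
  rewrite -[LHS]/(val _ == val _) val_eqE; by rewrite (inj_eq enum_rank_inj) (inj_eq g_inj).
have rw (w : V) : ((enum_rank w : nat) == enum_rank v) = (w == v).
  rewrite -[LHS]/(val _ == val _) val_eqE; by rewrite (inj_eq enum_rank_inj).
pose lt (w : V) := (enum_rank w < enum_rank v)%N.
pose ltg w := (enum_rank (g w) < enum_rank (g v))%N.
have eV : vertex_pos s v = #|[set w in s | lt w]%SET| by rewrite cardsE.
have eG : vertex_pos (g @: s)%SET (g v) = #|[set w in s | ltg w]%SET|.
  rewrite /vertex_pos -(card_imset _ g_inj); apply: eq_card => w'.
  rewrite !inE; apply/andP/imsetP => [[/imsetP[w ws ->] lw]|[w]].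
    by exists w; rewrite // inE ws.
  by rewrite inE => /andP[ws lw] ->; rewrite imset_f.
have eI : #|inversions s| = (#|inversions (s :\ v)%SET| +
    (#|[set w in s | lt w && ~~ ltg w]%SET| + #|[set w in s | ~~ lt w && ltg w]%SET|))%N.
  rewrite -(cardsID [set p | (p.1 == v) || (p.2 == v)]%SET) addnC; congr (_ + _)%N.
    apply: eq_card => -[a b]; rewrite !inE /= negb_or.
    by case: (a \in s); case: (b \in s); case: (a == v); case: (b == v); rewrite /= ?andbF ?andbT.
  rewrite -(cardsID [set p | p.2 == v]%SET); congr (_ + _)%N.
    rewrite -[RHS](@card_imset _ _ (fun w => (w, v))); last by move=> ? ? [].
    apply: eq_card => -[a b]; rewrite !inE /=; apply/idP/imsetP.
      move=> /andP[/andP[/andP[/andP[aS bS] /andP[ab ba]] _] /eqP bv]; subst b.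
      by exists a => //; rewrite inE aS /lt ab /ltg -leqNgt ltnW.
    case=> w; rewrite inE => /and3P[wS lw nlw] [-> ->]; rewrite wS vs eqxx orbT !andbT /= -/(lt w) lw /=.
    rewrite ltn_neqAle eq_sym rg; move: nlw; rewrite /ltg -leqNgt => ->; rewrite andbT.
    by apply: contraTneq lw => ->; rewrite /lt ltnn.
  rewrite -[RHS](@card_imset _ _ (fun w => (v, w))); last by move=> ? ? [].
  apply: eq_card => -[a b]; rewrite !inE /=; apply/idP/imsetP.
    move=> /andP[bv /andP[/andP[/andP[aS bS] /andP[ab ba]]]]; rewrite (negPf bv) orbF.
    move=> /eqP av; subst a.
    by exists b => //; rewrite inE bS /lt -leqNgt (ltnW ab) /ltg ba.
  case=> w; rewrite inE => /and3P[wS nlw lw] [-> ->]; rewrite wS vs eqxx /= -/(ltg w) lw !andbT.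
  have wv : w != v by apply: contraTneq lw => ->; rewrite /ltg ltnn.
  rewrite wv /= ltn_neqAle; move: nlw; rewrite /lt -leqNgt => ->; rewrite andbT.
  by rewrite eq_sym rw.
have eV' : #|[set w in s | lt w]%SET| =
    (#|[set w in s | lt w && ltg w]%SET| + #|[set w in s | lt w && ~~ ltg w]%SET|)%N.
  rewrite -(cardsID [set w | ltg w]%SET); congr (_ + _)%N; apply: eq_card => w; rewrite !inE.
    by rewrite andbA.
  by rewrite andbC -andbA.
have eG' : #|[set w in s | ltg w]%SET| =
    (#|[set w in s | lt w && ltg w]%SET| + #|[set w in s | ~~ lt w && ltg w]%SET|)%N.
  rewrite -(cardsID [set w | lt w]%SET); congr (_ + _)%N; apply: eq_card => w; rewrite !inE.
    by rewrite -andbA [ltg w && _]andbC.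
  by rewrite andbCA.
rewrite /orientation eI eV eG eV' eG' -!exprD -signr_odd -[RHS]signr_odd; congr (_ ^+ _).
rewrite !oddD; move: (odd _) (odd _) (odd _) (odd _) => [] [] [] [] //.
Qed.


Lemma imset_D1 s v : (g @: (s :\ v) = g @: s :\ g v)%SET.
Proof.
apply/setP => w; rewrite !inE; apply/imsetP/andP => [[u]|[wv /imsetP[u us wu]]].
  by rewrite !inE => /andP[uv us] ->; rewrite (inj_eq g_inj) imset_f.
by exists u => //; rewrite !inE us andbT; apply: contraNneq wv => <-; rewrite wu.
Qed.

Lemma simplex_boundary_image s : simplex_boundary F (g @: s)%SET =
  \sum_(v in s | (s :\ v)%SET != finset.set0)
    (-1) ^+ vertex_pos (g @: s)%SET (g v) *: simplex_chain F (g @: (s :\ v))%SET.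
Proof.
rewrite /simplex_boundary big_imset_cond; last by move=> ? ? _ _; exact: g_inj.
apply: eq_big => [v|v _]; last by rewrite imset_D1.
by rewrite -imset_D1 imset_eq0.
Qed.

(** [push] is the chain map of the injection [g]; [pull], which forgets the
    simplices outside the image of [g], is a left inverse of it. *)
Definition push (c : chain F V) : chain F V' :=
  \sum_s (orientation s * (c s : F)) *: simplex_chain F (g @: s)%SET.

Lemma push_is_linear : linear push.
Proof.
move=> a c d; rewrite /push scaler_sumr -big_split; apply: eq_bigr => s _.
rewrite !ffunE mulrDr scalerDl; congr (_ + _).
by rewrite scalerA; congr (_ *: _); exact: mulrCA.
Qed.

HB.instance Definition _ := GRing.isLinear.Build F _ _ *:%R push push_is_linear.

Definition pull (c : chain F V') : chain F V :=
  [ffun s => orientation s * (c (g @: s)%SET : F)].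

Lemma pull_is_linear : linear pull.
Proof.
move=> a c d; apply/ffunP => s; rewrite !ffunE mulrDr; congr (_ + _).
exact: mulrCA.
Qed.

HB.instance Definition _ := GRing.isLinear.Build F _ _ *:%R pull pull_is_linear.

Lemma push_simplex s :
  push (simplex_chain F s) = orientation s *: simplex_chain F (g @: s)%SET.
Proof.
rewrite /push (bigD1 s)//= big1 ?addr0 => [|t ts]; rewrite ffunE.
  by rewrite eqxx mulr1.
by rewrite (negPf ts) mulr0 scale0r.
Qed.

Lemma pull_image s :
  pull (simplex_chain F (g @: s)%SET) = orientation s *: simplex_chain F s.
Proof.
apply/ffunP => t; rewrite !ffunE (inj_eq (imset_inj g_inj)).
by case: eqP => [->//|_]; rewrite scaler0 mulr0.
Qed.

Lemma pull_nonimage t : (forall s, t != (g @: s)%SET) -> pull (simplex_chain F t) = 0.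
Proof.
by move=> tn; apply/ffunP => s; rewrite !ffunE eq_sym (negPf (tn s)) mulr0.
Qed.

Lemma boundary_push c : boundary F V' (push c) = push (boundary F V c).
Proof.
apply: (@linear_chain_eq _ _ _ (boundary F V' \o push) (push \o boundary F V)) => s _ /=.
rewrite push_simplex linearZ /= !boundary_simplex simplex_boundary_image.
rewrite /simplex_boundary scaler_sumr linear_sum; apply: eq_bigr => v /andP[vs _].
rewrite [RHS]linearZ /= push_simplex !scalerA; congr (_ *: _).
apply: (mulIr (x := orientation (s :\ v)%SET)).
  by apply/unitrP; exists (orientation (s :\ v)%SET); rewrite orientation_sqr.
rewrite -!mulrA orientation_sqr mulr1 orientationD1//.
by rewrite mulrA orientation_sqr mul1r.
Qed.

(** This is what makes [pull] commute with the boundary on the chains of [K]: a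
    simplex with vertices on both sides could have a face in the image of [g]. *)
Definition separated_image (K : {set {set V'}}) := forall t, t \in K ->
  t != finset.set0 /\
  ((exists s, t = g @: s)%SET \/ (forall v, g v \notin t)).

Lemma boundary_pull q (K : {set {set V'}}) c : separated_image K ->
  c \in chains F q K -> boundary F V (pull c) = pull (boundary F V' c).
Proof.
move=> sK cK.
apply: (@linear_chain_eq _ _ _ (boundary F V \o pull) (pull \o boundary F V')) => t /=.
move=> /(proj1 (chainsP _ _ _) cK)[tK _].
have [t0 [[s ts]|tn]] := sK t tK.
  subst t; rewrite pull_image linearZ /= !boundary_simplex simplex_boundary_image.
  rewrite /simplex_boundary scaler_sumr linear_sum; apply: eq_bigr => v /andP[vs _].
  by rewrite [RHS]linearZ /= pull_image !scalerA orientationD1.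
have disj (t' : {set V'}) : t' != finset.set0 -> t' \subset t -> pull (simplex_chain F t') = 0.
  case/finset.set0Pn => w wt' st'; apply: pull_nonimage => s; apply/eqP => t's.
  move: (wt'); rewrite t's => /imsetP[v _ wv].
  by move: (tn v); rewrite -wv (fintype.subsetP st').
rewrite disj// linear0 boundary_simplex /simplex_boundary linear_sum big1//= => v /andP[vt tv].
by rewrite linearZ /= disj ?scaler0// subD1set.
Qed.

Section Subspaces.
Variables (q : nat) (K : {set {set V}}) (K' : {set {set V'}}).

Lemma push_chains c : (forall s, s \in K -> (g @: s)%SET \in K') ->
  c \in chains F q K -> push c \in chains F q K'.
Proof.
move=> KK' cK; apply: memv_suml => s _.
have [->|/(proj1 (chainsP _ _ _) cK)[sK sq]] := eqVneq (c s) 0.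
  by rewrite mulr0 scale0r mem0v.
apply/memvZ/memv_span/map_f.
by rewrite mem_filter mem_enum KK'// card_imset// sq eqxx.
Qed.

Lemma pull_chains c : (forall s, (g @: s)%SET \in K' -> s \in K) ->
  c \in chains F q K' -> pull c \in chains F q K.
Proof.
move=> KK' cK; apply/chainsP => s; rewrite ffunE => cs.
have : c (g @: s)%SET != 0 by apply: contraNneq cs => ->; rewrite mulr0.
by case/(proj1 (chainsP _ _ _) cK) => /KK' -> <-; rewrite card_imset.
Qed.

Lemma push_cycles c : (forall s, s \in K -> (g @: s)%SET \in K') ->
  c \in cycles F q K -> push c \in cycles F q K'.
Proof.
move=> KK' /memv_capP[cK]; rewrite memv_ker => /eqP c0.
by rewrite memv_cap push_chains// memv_ker boundary_push c0 linear0 eqxx.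
Qed.

Lemma pull_cycles c : (forall s, (g @: s)%SET \in K' -> s \in K) ->
  separated_image K' -> c \in cycles F q K' -> pull c \in cycles F q K.
Proof.
move=> KK' sK /memv_capP[cK]; rewrite memv_ker => /eqP c0.
by rewrite memv_cap pull_chains// memv_ker (boundary_pull sK cK) c0 linear0 eqxx.
Qed.
End Subspaces.

Lemma push_boundaries q (K : {set {set V}}) (K' : {set {set V'}}) c :
  (forall s, s \in K -> (g @: s)%SET \in K') ->
  c \in boundaries F q K -> push c \in boundaries F q K'.
Proof.
move=> KK' /memv_imgP[b bK ->]; rewrite -boundary_push.
by apply: memv_img; exact: push_chains bK.
Qed.

Lemma pull_boundaries q (K : {set {set V}}) (K' : {set {set V'}}) c :
  (forall s, (g @: s)%SET \in K' -> s \in K) -> separated_image K' ->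
  c \in boundaries F q K' -> pull c \in boundaries F q K.
Proof.
move=> KK' sK /memv_imgP[b bK ->]; rewrite -(boundary_pull sK bK).
by apply: memv_img; exact: pull_chains bK.
Qed.

Lemma pushK : cancel push pull.
Proof.
move=> c; apply: (@linear_chain_eq _ _ _ (pull \o push) idfun) => s _ /=.
by rewrite push_simplex linearZ /= pull_image scalerA orientation_sqr scale1r.
Qed.

End ChainMap.

Lemma pull_push_disjoint (F : fieldType) (V V' : finType) (g h : V -> V')
    q (K : {set {set V}}) c :
  (forall u v, g u != h v) -> c \in chains F q K -> pull g (push h c) = 0.
Proof.
move=> gh cK; rewrite linear_sum big1//= => s _.
have [->|/(proj1 (chainsP _ _ _) cK)[_ sq]] := eqVneq (c s) 0.
  by rewrite mulr0 scale0r linear0.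
rewrite linearZ /= pull_nonimage ?scaler0// => t; apply/eqP => st.
have : (0 < #|s|)%N by rewrite sq.
case/card_gt0P => v vs; have : h v \in (h @: s)%SET by exact: imset_f.
by rewrite st => /imsetP[u _ /eqP]; rewrite eq_sym (negPf (gh u v)).
Qed.

(** * Perturbed and isolated copies of a point set *)

Section Kappa.
Variables (R : realType) (N : nat) (kappa : {fset 'rV[R]_N} -> \bar R).
Hypothesis kappaP : filtration_function kappa.
Implicit Types (sigma tau Xi : {fset 'rV[R]_N}).

Lemma enorm_ge0 (x : 'rV[R]_N) : 0 <= enorm x.
Proof. exact: sqrtr_ge0. Qed.

(** The lower bound by 0 serves for a Lipschitz constant of unknown sign. *)
Lemma hausdorff_dist_le sigma tau (e : R) : sigma != fset0 -> tau != fset0 ->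
  (forall x, x \in sigma -> exists2 y, y \in tau & enorm (x - y) <= e) ->
  (forall y, y \in tau -> exists2 x, x \in sigma & enorm (x - y) <= e) ->
  0 <= hausdorff_dist sigma tau <= e.
Proof.
move=> /fset0Pn[x0 x0s] /fset0Pn[y0 y0t] st ts.
pose Sx x := [set enorm (x - y) | y in [set` tau]].
pose Sy y := [set enorm (x - y) | x in [set` sigma]].
have Sx0 x : has_inf (Sx x).
  split; first by exists (enorm (x - y0)); exists y0.
  by exists 0 => _ [y _ <-]; exact: enorm_ge0.
have Sy0 y : has_inf (Sy y).
  split; first by exists (enorm (x0 - y)); exists x0.
  by exists 0 => _ [x _ <-]; exact: enorm_ge0.
have Ax : ubound [set inf (Sx x) | x in [set` sigma]] e.
  move=> _ [x xs <-]; have [y yt xy] := st x xs.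
  by apply: le_trans xy; apply: (ge_inf (Sx0 x).2); exists y.
have Ay : ubound [set inf (Sy y) | y in [set` tau]] e.
  move=> _ [y yt <-]; have [x xs xy] := ts y yt.
  by apply: le_trans xy; apply: (ge_inf (Sy0 y).2); exists x.
rewrite /hausdorff_dist le_max ge_max; apply/andP; split; last first.
  apply/andP; split; apply: ge_sup => //.
    by exists (inf (Sx x0)); exists x0.
  by exists (inf (Sy y0)); exists y0.
apply/orP; left; apply: (@le_trans _ _ (inf (Sx x0))).
  by apply: (lb_le_inf (Sx0 x0).1) => _ [y _ <-]; exact: enorm_ge0.
by apply: ub_le_sup; [exists e | exists x0].
Qed.

Hypothesis lip : hausdorff_lipschitz kappa.

(** An infinite value would make [`|kappa sigma - kappa sigma|] infinite. *)
Lemma kappa_fin sigma : sigma != fset0 -> kappa sigma \is a fin_num.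
Proof.
have [c cP] := lip => s0; have := cP _ _ s0 s0.
by case: (kappa sigma).
Qed.

Lemma kappa_lip : exists2 c : R, 0 <= c & forall sigma tau (e : R),
  sigma != fset0 -> tau != fset0 ->
  (forall x, x \in sigma -> exists2 y, y \in tau & enorm (x - y) <= e) ->
  (forall y, y \in tau -> exists2 x, x \in sigma & enorm (x - y) <= e) ->
  `|fine (kappa sigma) - fine (kappa tau)| <= c * e.
Proof.
have [c cP] := lip; exists `|c| => // sigma tau e s0 t0 st ts.
have /andP[h0 he] := hausdorff_dist_le s0 t0 st ts.
have := cP _ _ s0 t0; rewrite -(fineK (kappa_fin s0)) -(fineK (kappa_fin t0)).
rewrite -EFinB /= lee_fin => /le_trans; apply.
apply: (@le_trans _ _ (`|c| * hausdorff_dist sigma tau)); last exact: ler_wpM2l.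
by rewrite ler_wpM2r// ler_norm.
Qed.

Definition face_of Xi (s : {set Xi}) := [fset val x | x in s]%fset.

(** By translation invariance the translation vector [a] is free. *)
Lemma kappa_perturbed : exists2 c : R, 0 <= c &
  forall Xi0 Xi (g : Xi0 -> Xi) (a : 'rV[R]_N) (e : R),
  (forall x, enorm (val (g x) - (val x + a)) <= e) ->
  forall s : {set Xi0}, s != finset.set0 ->
  `|fine (kappa (face_of (g @: s)%SET)) - fine (kappa (face_of s))| <= c * e.
Proof.
have [c c0 cP] := kappa_lip; exists c => // Xi0 Xi g a e ge s s0.
have fs0 : face_of s != fset0 by exact: face_neq0.
rewrite -(kappa_translation kappaP a fs0); apply: cP.
- by apply: face_neq0; rewrite imset_eq0.
- case/finset.set0Pn: s0 => x xs; apply/fset0Pn; exists (val x + a).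
  by apply/imfsetP; exists (val x) => //; apply/imfsetP; exists x.
- move=> _ /imfsetP[y /imsetP[x xs ->] ->]; exists (val x + a); last exact: ge.
  by apply/imfsetP; exists (val x) => //; apply/imfsetP; exists x.
- move=> _ /imfsetP[_ /imfsetP[x xs ->] ->]; exists (val (g x)); last exact: ge.
  by apply/imfsetP; exists (g x) => //; exact: imset_f.
Qed.

(** A perturbation smaller than the distance of [t] to the values of [kappa] leaves
    the complex at time [t] unchanged. *)
Lemma cplx_perturbed (eta t : R) Xi0 Xi (g : Xi0 -> Xi) (s : {set Xi0}) :
  (s != finset.set0 ->
    `|fine (kappa (face_of (g @: s)%SET)) - fine (kappa (face_of s))| <= eta) ->
  (s != finset.set0 -> eta < `|fine (kappa (face_of s)) - t|) ->
  ((g @: s)%SET \in cplx kappa Xi t) = (s \in cplx kappa Xi0 t).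
Proof.
rewrite !inE imset_eq0; have [//|s0] := eqVneq s finset.set0 => /= /(_ isT) h1 /(_ isT) h2.
have gs0 : (g @: s)%SET != finset.set0 by rewrite imset_eq0.
rewrite -!/(face_of _) -(fineK (kappa_fin (face_neq0 s0))) -(fineK (kappa_fin (face_neq0 gs0))).
rewrite !lee_fin; move: (fine (kappa (face_of s))) (fine (kappa (face_of (g @: s)%SET))) h1 h2 => u v.
rewrite ler_norml => /andP[uv vu]; case: (lerP u t) => ut.
  by move=> ?; apply/idP; lra.
by move=> ?; apply/negbTE; rewrite -ltNge; lra.
Qed.

(** Since [rho] bounds distances in terms of [kappa], two points farther apart than
    [rho T] span no edge before time [T]. *)
Lemma cplx_separated (rho : \bar R -> \bar R) (M T t : R) Xi0 Xi (g : Xi0 -> Xi) :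
  (forall s u, (0 <= s)%E -> (s <= u)%E -> (rho s <= rho u)%E) ->
  (forall x y, ((enorm (x - y))%:E <= rho (kappa [fset x; y]%fset))%E) ->
  (rho T%:E < M%:E)%E -> t <= T ->
  (forall x y, (forall x', g x' != y) -> M <= enorm (val y - val (g x))) ->
  separated_image g (cplx kappa Xi t).
Proof.
move=> rhoM rhoP rhoT tT sep tau; rewrite inE => /andP[t0 kt]; split=> //.
have [[x xt]|nx] := pselect (exists x, g x \in tau); last first.
  by right=> x; apply/negP => xt; apply: nx; exists x.
left; exists (g @^-1: tau)%SET; apply/setP => y; apply/idP/imsetP => [yt|[x' + ->]]; last first.
  by rewrite inE.
have [[x' x'y]|ny] := pselect (exists x', g x' = y); first by exists x'; rewrite // inE x'y.
have : M <= enorm (val y - val (g x)).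
  by apply: sep => x'; apply/eqP => x'y; apply: ny; exists x'.
rewrite leNgt; case/negP; rewrite -lte_fin; apply: le_lt_trans rhoT.
apply: le_trans (rhoP _ _) _; have p0 : [fset val y; val (g x)]%fset != fset0.
  by apply/fset0Pn; exists (val y); rewrite !inE eqxx.
apply: rhoM; first exact: kappa_ge0.
apply: (@le_trans _ _ t%:E); last by rewrite lee_fin.
apply: le_trans kt; apply: kappa_mono => //.
by apply/fsubsetP => z; rewrite !inE => /orP[]/eqP ->; apply/imfsetP; [exists y|exists (g x)].
Qed.

End Kappa.

(** Isolated copies of [Xi0] contribute additively.  A cycle of [Xi0] that witnesses
    a bar of the rectangle is pushed to each of the copies; pulling back to one copy
    kills the cycles of the others and preserves the spaces [rect_lower], so that
    the pushed cycles are independent modulo [rect_lower]. *)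
Section Clusters.
Variables (R : realType) (N : nat) (kappa : {fset 'rV[R]_N} -> \bar R).
Hypothesis kappaP : filtration_function kappa.
Variables (F : fieldType) (q : nat) (Xi0 Xi : {fset 'rV[R]_N}).
Variables (a1 a2 c1 : R) (c2 : option R).
Hypotheses (a12 : a1 <= a2) (a20 : 0 <= a2) (ac : a2 < c1).
Hypothesis (cc : if c2 is Some c then c1 <= c else true).
Variables (n : nat) (g : 'I_n -> Xi0 -> Xi).
Hypothesis g_inj : forall j, injective (g j).
Hypothesis g_disj : forall j k x y, j != k -> g j x != g k y.
Let used t := t = a1 \/ t = a2 \/ t = c1 \/ c2 = Some t.
Hypothesis g_cplx : forall j t (s : {set Xi0}), used t ->
  ((g j @: s)%SET \in cplx kappa Xi t) = (s \in cplx kappa Xi0 t).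
Hypothesis g_sep : forall j t, used t -> separated_image (g j) (cplx kappa Xi t).

Let used1 : used a1. Proof. by left. Qed.
Let used2 : used a2. Proof. by right; left. Qed.
Let used3 : used c1. Proof. by right; right; left. Qed.

Lemma cluster_count ds0 ds :
  decomposes (persistent_homology kappa F q Xi0) ds0 ->
  decomposes (persistent_homology kappa F q Xi) ds ->
  has (in_rect a1 a2 c1 c2) ds0 -> (n <= count (in_rect a1 a2 c1 c2) ds)%N.
Proof.
move=> [D0 [phi0 [bij0 nat0]]] [D [phi [bij nat']]] h0.
have k0 := kappa_ge0 kappaP.
have [z /memv_capP[zZ zD] zL] := rect_has k0 a12 a20 ac cc bij0 nat0 h0.
apply: (rect_count_ge a12 a20 ac cc D bij nat' (z := fun j => push (g j) z)) => [j|u uL j].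
  rewrite memv_cap; apply/andP; split.
    by apply: push_cycles zZ => // s; rewrite g_cplx.
  move: zD; case c2E: c2 => [c|] zD; last exact: memvf.
  by apply: push_boundaries zD => // s; rewrite g_cplx//; right; right; right.
apply: contraNeq zL => uj.
have : u j *: z \in rect_lower F q (cplx kappa Xi0) a1 a2 c1 c2; last first.
  by move=> /(memvZ (u j)^-1); rewrite scalerA mulVf// scale1r.
have -> : u j *: z = pull (g j) (\sum_k u k *: push (g k) z).
  rewrite linear_sum (bigD1 j)//= big1 ?addr0 => [|k kj].
    by rewrite linearZ /= pushK.
  rewrite linearZ /= (@pull_push_disjoint _ _ _ _ _ q (cplx kappa Xi0 a2)) ?scaler0//.
    by move=> x y; rewrite g_disj// eq_sym.
  by case/memv_capP: zZ.
have gc t (s : {set Xi0}) : used t -> (g j @: s)%SET \in cplx kappa Xi t -> s \in cplx kappa Xi0 t.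
  by move=> ut; rewrite g_cplx.
case/memv_addP: uL => x /memv_capP[xZ xD] [y /memv_capP[yZ yB] ->].
rewrite linearD; apply: memv_add; rewrite memv_cap; apply/andP; split.
- by apply: (pull_cycles (g_inj (j := j))) xZ => // [s|]; [exact: gc|exact: g_sep].
- move: xD; case c2E: c2 => [c|] xD; last exact: memvf.
  have uc : used c by right; right; right.
  by apply: (pull_boundaries (g_inj (j := j))) xD => // [s|]; [exact: gc|exact: g_sep].
- by apply: (pull_cycles (g_inj (j := j))) yZ => // [s|]; [exact: gc|exact: g_sep].
- by apply: (pull_boundaries (g_inj (j := j))) yB => // [s|]; [exact: gc|exact: g_sep].
Qed.

End Clusters.

Lemma finite_gap (R : realType) (s : seq R) (x : R) :
  exists2 m, 0 < m & forall v, v \in s -> v != x -> m <= `|v - x|.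
Proof.
elim: s => [|v s [m m0 IH]]; first by exists 1.
have [->|vx] := eqVneq v x.
  by exists m => // w; rewrite inE => /orP[/eqP ->|/IH//]; rewrite eqxx.
exists (Num.min m `|v - x|); first by rewrite lt_min m0 normr_gt0 subr_eq0.
move=> w; rewrite inE => /orP[/eqP ->|/IH h /h]; rewrite ge_min ?lexx ?orbT//.
by move=> ->.
Qed.

Section Realizable.
Variables (R : realType) (N : nat) (kappa : {fset 'rV[R]_N} -> \bar R).
Hypothesis kappaP : filtration_function kappa.
Hypothesis lip : hausdorff_lipschitz kappa.
Variables (F : fieldType) (q : nat).

Lemma diagram_decomposes Xi : decomposes (persistent_homology kappa F q Xi)
  (diagram (persistent_homology kappa F q Xi)).
Proof.
have [ds dsP] := persistent_homology_decomposes (kappa_ge0 kappaP) F q Xi.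
exact: (@xgetPex _ [::] [set ds | decomposes (persistent_homology kappa F q Xi) ds] (ex_intro _ ds dsP)).
Qed.

Lemma diagram_measure_ge (M : persmod R F) (P : pred (\bar R * \bar R)) A :
  (forall p, p \in diagram M -> P p -> A p) ->
  ((count P (diagram M))%:R%:E <= diagram_measure M A)%E.
Proof.
rewrite /diagram_measure; elim: (diagram M) => [|p s IH] PA.
  by rewrite big_nil.
rewrite big_cons /= natrD EFinD leeD//; last first.
  by apply: IH => r rs; apply: PA; rewrite inE rs orbT.
rewrite diracE lee_fin; case: (boolP (P p)) => [/(PA p (mem_head _ _)) Ap|]; last by [].
by rewrite mem_set.
Qed.

Lemma xi_eq0 Xi A : (forall p, p \in diagram (persistent_homology kappa F q Xi) -> ~ A p) ->
  xi kappa F q Xi A = 0%E.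
Proof.
move=> nA; rewrite /xi /diagram_measure big1_seq// => p /andP[_ /nA Ap].
by rewrite diracE memNset.
Qed.

Lemma realizable_mem Xi p : (1 <= xi kappa F q Xi [set p])%E ->
  p \in diagram (persistent_homology kappa F q Xi).
Proof.
apply: contraTT => pn; rewrite xi_eq0 ?lee_fin ?ler10//.
by move=> r rd /= rp; rewrite -rp rd in pn.
Qed.

(** The geometric situation that a suitable local event produces in [n] disjoint
    cells, and the only information on [Xi] needed to count its bars. *)
Definition near_copies (d M : R) (Xi0 Xi : {fset 'rV[R]_N}) n (g : 'I_n -> Xi0 -> Xi) :=
  [/\ forall j, injective (g j), forall j k x y, j != k -> g j x != g k y,
    forall j, exists a, forall x, enorm (val (g j x) - (val x + a)) <= d &
    forall j x y, (forall x', g j x' != y) -> M <= enorm (val y - val (g j x))].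

(** Around a realizable point there is a rectangle, as small as desired, whose sides
    are not values of [kappa] on the realizing set [Xi0].  Its bars are then stable
    under small perturbations of [Xi0], so that each isolated copy of [Xi0] in [Xi]
    contributes at least one point. *)
Lemma copies_xi_ge (b e T : R) (d : \bar R) : 0 < e -> realizable kappa F q (b%:E, d) ->
  exists (Xi0 : {fset 'rV[R]_N}) (a1 a2 c1 : R) (c2 : option R) (delta M : R),
  [/\ Xi0 != fset0, 0 < delta, 0 < M,
    [/\ b - e < a1, a2 < b + e &
    match d with
    | EFin d' => d' - e < c1 /\ exists2 c, c2 = Some c & c < d' + e
    | _ => T < c1 end] &
    forall (Xi : {fset 'rV[R]_N}) n (g : 'I_n -> Xi0 -> Xi) A, near_copies delta M g ->
      (forall p, Delta p -> in_rect a1 a2 c1 c2 p -> A p) -> (n%:R%:E <= xi kappa F q Xi A)%E].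
Proof.
move=> e0 [[/= b0 bd]] [Xi0 Xi00 /realizable_mem bdXi0].
pose vals := [seq fine (kappa (face_of s)) | s : {set Xi0}].
have valsP (s : {set Xi0}) : fine (kappa (face_of s)) \in vals.
  by apply/mapP; exists s; rewrite ?mem_enum.
have [c c_ge0 cP] := kappa_perturbed kappaP lip.
have [rho [rho0 rhoM rho_fin rhoP]] := kappa_rho kappaP.
have [mb mb0 mbP] := finite_gap vals b.
rewrite lee_fin in b0.
suff [a1 [a2 [c1 [c2 [eta [eta0 [a12 a20 ac cc] near rect gap]]]]]] :
    exists (a1 a2 c1 : R) (c2 : option R) (eta : R), [/\ 0 < eta,
      [/\ a1 <= a2, 0 <= a2, a2 < c1 & is_true (if c2 is Some c then c1 <= c else true)],
      [/\ b - e < a1, a2 < b + e & match d with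
        | EFin d' => d' - e < c1 /\ exists2 c, c2 = Some c & c < d' + e
        | _ => T < c1 end], in_rect a1 a2 c1 c2 (b%:E, d) &
      forall t, t = a1 \/ t = a2 \/ t = c1 \/ c2 = Some t ->
        forall v, v \in vals -> eta < `|v - t|].
  pose T' := if c2 is Some c then c else c1.
  have T'0 : 0 <= T' by rewrite /T'; case: (c2) cc => [x|_]; lra.
  have usedT' t : t = a1 \/ t = a2 \/ t = c1 \/ c2 = Some t -> t <= T'.
    rewrite /T'; case: (c2) cc => [x cx|_] [->|[->|[->|//]]]; try lra.
    by case=> ->.
  pose M := fine (rho T'%:E) + 1.
  have rhoT' : rho T'%:E \is a fin_num.
    by rewrite ge0_fin_numE ?rho0 ?rho_fin ?lee_fin// ltry.
  have delta0 : 0 < eta / (c + 1) by rewrite divr_gt0// ltr_wpDl.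
  exists Xi0, a1, a2, c1, c2, (eta / (c + 1)), M; split=> //.
    by rewrite /M ltr_wpDl// fine_ge0// rho0 ?lee_fin.
  move=> Xi n g A [g_inj g_disj g_near g_sep] rA.
  have rA' p : p \in diagram (persistent_homology kappa F q Xi) ->
      in_rect a1 a2 c1 c2 p -> A p.
    by move=> /((diagram_decomposes Xi).1 p); exact: rA.
  apply: (le_trans _ (diagram_measure_ge rA')); rewrite lee_fin ler_nat.
  have D0 := diagram_decomposes Xi0; have D := diagram_decomposes Xi.
  refine (@cluster_count _ _ _ kappaP F q Xi0 Xi a1 a2 c1 c2 a12 a20 ac cc n g g_inj g_disj _ _ _ _ D0 D _).
  - move=> j t s ut; have [a ga] := g_near j.
    apply: (cplx_perturbed lip (eta := eta)) => s0; last exact: gap.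
    apply: le_trans (cP _ _ _ _ _ ga s s0) _.
    rewrite mulrA ler_pdivrMr ?ltr_wpDl// mulrC ler_wpM2l// ?lerDl//.
    exact: ltW.
  - move=> j t ut; apply: (cplx_separated kappaP rhoM rhoP _ (usedT' _ ut) (M := M)).
      by rewrite -(fineK rhoT') lte_fin /M ltrDl.
    by move=> x y; exact: g_sep.
  - by apply/hasP; exists (b%:E, d).
case: d bd bdXi0 => [d||]; rewrite ?lte_fin// => bd bdXi0.
  have [md md0 mdP] := finite_gap vals d.
  (* The values of kappa other than b and d stay at distance at least m from them;
     hence b +- m/2 and d +- m/2 are farther than m/4 from every value. *)
  pose m := Num.min (Num.min mb md) (Num.min e ((d - b) / 2)).
  have m0 : 0 < m by rewrite !lt_min mb0 md0 e0 divr_gt0// subr_gt0.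
  have [m1 m2 m3 m4] : [/\ m <= mb, m <= md, m <= e & m <= (d - b) / 2].
    by rewrite /m !ge_min !lexx ?orbT.
  exists (b - m / 2), (b + m / 2), (d - m / 2), (Some (d + m / 2)), (m / 4).
  split; first lra.
  - by split; lra.
  - by split; [lra|lra|split; [lra|exists (d + m / 2) => //; lra]].
  - by rewrite /in_rect /= !lte_fin !lee_fin; apply/and4P; split; lra.
  - have gap x v : (v != x -> m <= `|v - x|) -> m / 4 < `|v - (x - m / 2)| /\ m / 4 < `|v - (x + m / 2)|.
      have [->|_ /(_ isT)] := eqVneq v x => [_|].
        by split; rewrite ltr_normr; apply/orP; [left|right]; lra.
      by rewrite ler_normr => /orP[h|h]; split; rewrite ltr_normr; apply/orP; (left; lra) || (right; lra).
    have gb v : v \in vals -> v != b -> m <= `|v - b| by move=> vv vb; apply: le_trans m1 (mbP _ vv vb).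
    have gd v : v \in vals -> v != d -> m <= `|v - d| by move=> vv vb; apply: le_trans m2 (mdP _ vv vb).
    move=> t [->|[->|[->|[<-]]]] v vv.
    + exact: (gap _ _ (gb v vv)).1.
    + exact: (gap _ _ (gb v vv)).2.
    + exact: (gap _ _ (gd v vv)).1.
    + exact: (gap _ _ (gd v vv)).2.
pose m := Num.min mb (Num.min e 1).
have m0 : 0 < m by rewrite !lt_min mb0 e0 ltr01.
have [m1 m2 m3] : [/\ m <= mb, m <= e & m <= 1].
  by rewrite /m !ge_min !lexx ?orbT.
(* The time c1 is chosen beyond every value of kappa. *)
pose S := \sum_(v <- vals) `|v|.
have SP v : v \in vals -> v <= S.
  move=> vv; apply: le_trans (ler_norm v) _; rewrite /S (big_rem v)//= lerDl.
  by apply: sumr_ge0.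
have S0 : 0 <= S by apply: sumr_ge0.
exists (b - m / 2), (b + m / 2), (S + `|T| + b + 2), None, (m / 4).
have TT := ler_norm T; have TT0 := normr_ge0 T.
split; first lra.
- by split => //; lra.
- by split; lra.
- by rewrite /in_rect /= !lte_fin !lee_fin ltry; apply/and4P; split => //; lra.
- have gb v : v \in vals -> v != b -> m <= `|v - b| by move=> vv vb; apply: le_trans m1 (mbP _ vv vb).
  have gap v : v \in vals -> m / 4 < `|v - (b - m / 2)| /\ m / 4 < `|v - (b + m / 2)|.
    move=> /gb; have [->|_ /(_ isT)] := eqVneq v b => [_|].
      by split; rewrite ltr_normr; apply/orP; [left|right]; lra.
    by rewrite ler_normr => /orP[h|h]; split; rewrite ltr_normr; apply/orP; (left; lra) || (right; lra).
  move=> t [->|[->|[->|//]]] v vv.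
  + exact: (gap v vv).1.
  + exact: (gap v vv).2.
  + by have := SP _ vv; rewrite ltr_normr => ?; apply/orP; right; lra.
Qed.

Lemma xi_fset0 A : xi kappa F q fset0 A = 0%E.
Proof.
apply: xi_eq0 => -[b d] bd _.
have [D [phi [bij nat']]] := diagram_decomposes fset0.
have [/= b0 bltd] := D _ bd.
have [b' bE] : exists b' : R, b = b'%:E.
  case: b b0 bltd {bd} => [b' _ _|_|//]; first by exists b'.
  by rewrite ltNge leey.
subst b; rewrite lee_fin in b0.
have [c bc cd] : exists2 c, b' < c & (c%:E < d)%E.
  case: d bltd {bd} => [d||]//; rewrite ?lte_fin => bd.
    by exists ((b' + d) / 2); rewrite ?lte_fin; lra.
  by exists (b' + 1); rewrite ?ltrDl ?ltry.
have k0 := kappa_ge0 kappaP.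
have a12 : b' - 1 <= b' by lra.
have := @rect_has _ _ _ k0 F q fset0 (b' - 1) b' c None a12 b0 bc isT _ phi bij nat'.
case.
  by apply/hasP; exists (b'%:E, d) => //; rewrite /in_rect /= lte_fin lexx cd !andbT; lra.
move=> z /memv_capP[+ _]; rewrite /cycles.
have -> : cplx kappa fset0 b' = finset.set0.
  apply/setP => s; rewrite !inE; apply/negP => /andP[/finset.set0Pn[x _] _].
  by case: x.
by rewrite chains_set0 cap0v memv0 => /eqP ->; rewrite mem0v.
Qed.

End Realizable.

(** * Volume of cubes *)

Definition halfopen_indic (R : realType) (a b x : R) : R := ((a <= x) && (x < b))%R%:R.

Lemma halfopen_indicE (R : realType) (a b : R) :
  halfopen_indic a b = \1_(`[a, b[%classic : set R).
Proof.
by apply/funext => x; rewrite indicE /halfopen_indic mem_setE in_itv.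
Qed.

Lemma lebesgue_measure_co (R : realType) (a b : R) : a <= b ->
  lebesgue_measure (`[a, b[%classic : set R) = (b - a)%:E.
Proof.
by rewrite lebesgue_measure_itv /= lte_fin; case: ltgtP => // -> _; rewrite subrr.
Qed.

(** The inequality is integrated over the line; the series and the integral are
    exchanged by monotone convergence. *)
Lemma cover_line (R : realType) (p s w : R) (e a b : nat -> R) :
  0 <= s -> 0 <= w -> (forall k, 0 <= e k) -> (forall k, a k <= b k) ->
  (forall y, p <= y < p + s ->
    (w%:E <= \sum_(k <oo) (e k * halfopen_indic (a k) (b k) y)%:E)%E) ->
  ((w * s)%:E <= \sum_(k <oo) (e k * (b k - a k))%:E)%E.
Proof.
move=> s0 w0 e0 ab cov; pose mu := @lebesgue_measure R.
have -> : (\sum_(k <oo) (e k * (b k - a k))%:E =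
    \int[mu]_y (\sum_(k <oo) (e k * halfopen_indic (a k) (b k) y)%:E))%E.
  rewrite integral_nneseries //; last 2 first.
  - move=> k; apply/measurable_EFinP/measurable_funM => //.
    by rewrite halfopen_indicE; exact: measurable_indic.
  - by move=> k y _; rewrite lee_fin mulr_ge0.
  apply: eq_eseriesr => k _; under eq_integral do rewrite EFinM.
  rewrite ge0_integralZl//; last 3 first.
  - by apply/measurable_EFinP; rewrite halfopen_indicE; exact: measurable_indic.
  - by move=> y _; rewrite lee_fin.
  - by rewrite lee_fin.
  rewrite halfopen_indicE integral_indic// setIT EFinM; congr (_ * _)%E.
  exact/esym/lebesgue_measure_co.
have -> : ((w * s)%:E = \int[mu]_(y in `[p, (p + s)%R[) w%:E)%E.
  rewrite integral_cst// EFinM; congr (_ * _)%E.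
  have := @lebesgue_measure_co R p (p + s); rewrite lerDl => /(_ s0).
  by rewrite addrAC subrr add0r => /esym; exact.
apply: (@le_trans _ _ (\int[mu]_(y in `[p, (p + s)%R[)
    (\sum_(k <oo) (e k * halfopen_indic (a k) (b k) y)%:E))%E).
  apply: ge0_le_integral => //.
  apply: ge0_emeasurable_sum => k => [y _ _|_]; first by rewrite lee_fin mulr_ge0.
  apply/measurable_EFinP/measurable_funM => //.
  by rewrite halfopen_indicE; exact: measurable_indic.
apply: ge0_subset_integral => //.
- apply: ge0_emeasurable_sum => k => [y _ _|_]; first by rewrite lee_fin mulr_ge0.
  apply/measurable_EFinP/measurable_funM => //.
  by rewrite halfopen_indicE; exact: measurable_indic.
- by move=> y _; apply: nneseries_ge0 => k _ _; rewrite lee_fin mulr_ge0.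
Qed.

(** The coordinates are integrated one at a time.  The weights [e] absorb the lengths
    of the sides that have been integrated. *)
Lemma cover_cube (R : realType) (n : nat) (p : 'I_n -> R) (s w : R)
    (e : nat -> R) (a b : nat -> 'I_n -> R) :
  0 <= s -> 0 <= w -> (forall k, 0 <= e k) -> (forall k i, a k i <= b k i) ->
  (forall x : 'I_n -> R, (forall i, p i <= x i < p i + s) ->
    (w%:E <= \sum_(k <oo) (e k * \prod_i halfopen_indic (a k i) (b k i) (x i))%:E)%E) ->
  ((w * s ^+ n)%:E <= \sum_(k <oo) (e k * \prod_i (b k i - a k i))%:E)%E.
Proof.
move=> s0; elim: n p w e a b => [|n IH] p w e a b w0 e0 ab cov.
  have := cov (fun=> 0); rewrite expr0 mulr1 => /(_ _)/le_trans; apply; first by case.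
  by rewrite le_eqVlt; apply/orP; left; apply/eqP/eq_eseriesr => k _; rewrite !big_ord0.
have := IH (fun i => p (lift ord0 i)) (w * s) (fun k => e k * (b k ord0 - a k ord0))
  (fun k i => a k (lift ord0 i)) (fun k i => b k (lift ord0 i)).
rewrite -mulrA -exprS => /(_ _ _ _ _)/le_trans; apply.
- exact: mulr_ge0.
- by move=> k; rewrite mulr_ge0// subr_ge0.
- by move=> k i.
- move=> x xp; under eq_eseriesr do rewrite mulrAC.
  apply: (@cover_line _ (p ord0)) => // [k|y yp].
    by rewrite mulr_ge0// prodr_ge0// => i _.
  have := cov (fun i => oapp x y (unlift ord0 i)); move=> /(_ _)/le_trans; apply.
    by move=> i; case: unliftP => [j ->|->] /=.
  rewrite le_eqVlt; apply/orP; left; apply/eqP/eq_eseriesr => k _; congr EFin.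
  rewrite -mulrA; congr (_ * _); rewrite big_ord_recl unlift_none /= mulrC; congr (_ * _).
  by apply: eq_bigr => i _; rewrite liftK.
- rewrite le_eqVlt; apply/orP; left; apply/eqP/eq_eseriesr => k _; congr EFin.
  by rewrite -mulrA big_ord_recl.
Qed.

Definition cube (R : realType) (N : nat) (p : 'rV[R]_N) (s : R) : set 'rV[R]_N :=
  [set x | forall i, p ord0 i <= x ord0 i < p ord0 i + s].

(** The outer measure must be bounded below for every countable cover; the upper
    bound is given by the cover that consists of the cube itself, and ensures that
    [fine] does not return a default value. *)
Lemma volume_cube_gt0 (R : realType) (N : nat) (p : 'rV[R]_N) (s : R) :
  (0 < N)%N -> 0 < s -> 0 < fine (volume (cube p s)).
Proof.
move=> N0 s0.
have lb : ((s ^+ N)%:E <= volume (cube p s))%E.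
  apply: le_ereal_inf_tmp => _ [[a b] /= [ab cov] <-].
  have := @cover_cube R N (fun i => p ord0 i) s 1 (fun=> 1) (fun k i => a k ord0 i)
    (fun k i => b k ord0 i) (ltW s0) ler01 (fun=> ler01) ab.
  rewrite mul1r; move=> /(_ _)/le_trans; apply; last first.
    by rewrite le_eqVlt; apply/orP; left; apply/eqP/eq_eseriesr => k _; rewrite mul1r.
  move=> x xp; have /cov[k _ /= xk] : cube p s (\row_i x i) by move=> i; rewrite mxE.
  rewrite (@nneseriesD1 _ _ k)//; last first.
    by move=> j _; rewrite lee_fin mul1r prodr_ge0.
  rewrite big1 => [|i _]; last by have := xk i; rewrite mxE /halfopen_indic => ->.
  by rewrite mul1r leeDl// nneseries_ge0// => j _ _; rewrite lee_fin mul1r prodr_ge0.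
have ub : (volume (cube p s) <= (s ^+ N)%:E)%E.
  (* The boxes after the first one are empty. *)
  pose B (k : nat) : 'rV[R]_N := if k == 0%N then \row_i (p ord0 i + s) else p.
  apply: ereal_inf_lbound; exists (fun=> p, B) => /=.
    split=> [k i|x xp]; first by rewrite /B; case: eqP => _; rewrite ?mxE// lerDl ltW.
    by exists 0%N => // i; rewrite /B eqxx mxE; exact: xp.
  have B0 (k : nat) : (0 < k)%N -> \prod_i (B k ord0 i - p ord0 i) = 0 :> R.
    case: k => // k _; rewrite /B /=; under eq_bigr do rewrite subrr.
    by rewrite prodr_const card_ord expr0n; case: (N) N0.
  have BN : \prod_i (B 0%N ord0 i - p ord0 i) = s ^+ N :> R.
    rewrite /B /=; under eq_bigr do rewrite mxE addrAC subrr add0r.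
    by rewrite prodr_const card_ord.
  rewrite nneseries_recl//; last first.
    by case=> [|k] _; rewrite lee_fin ?BN ?B0// exprn_ge0// ltW.
  by rewrite eseries0 ?adde0 ?BN// => k k0 _; rewrite B0.
have sN : 0 < s ^+ N by rewrite exprn_gt0.
move: lb ub; case: (volume _) => [v||] //=; rewrite !lee_fin => sv _.
exact: lt_le_trans sv.
Qed.

(** * Atoms of configurations *)

Section Borel.
Variables (R : realType) (N : nat).
Local Notation E := (euclid R N).

Lemma measurable_coord_lt (i : 'I_N) (c : R) :
  measurable ([set x : 'rV[R]_N | x ord0 i < c] : set E).
Proof.
apply: sub_sigma_algebra.
rewrite -[X in open X]/((fun x : 'rV[R]_N => x ord0 i) @^-1` [set y | y < c]).
by apply: open_comp => [x _|]; [exact: coord_continuous|exact: open_lt].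
Qed.

Lemma measurable_coord_ge (i : 'I_N) (c : R) :
  measurable ([set x : 'rV[R]_N | c <= x ord0 i] : set E).
Proof.
rewrite (_ : [set _ | _] = ~` [set x : 'rV[R]_N | x ord0 i < c]).
  by apply: measurableC; exact: measurable_coord_lt.
by apply/seteqP; split => x /=; rewrite leNgt => /negP.
Qed.

Lemma measurable_cube (p : 'rV[R]_N) (s : R) : measurable (cube p s : set E).
Proof.
rewrite (_ : cube p s = \bigcap_(i in [set: 'I_N])
   ([set x : 'rV[R]_N | p ord0 i <= x ord0 i] `&` [set x : 'rV[R]_N | x ord0 i < p ord0 i + s])).
  apply: fin_bigcap_measurable => // i _.
  by apply: measurableI; [exact: measurable_coord_ge|exact: measurable_coord_lt].
apply/seteqP; split => x /= xp i; first by move=> _; have /andP := xp i.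
by apply/andP; exact: (xp i Logic.I).
Qed.

Lemma measurable_point (x : 'rV[R]_N) : measurable ([set x] : set E).
Proof.
rewrite -(setCK [set x]); apply: measurableC; apply: sub_sigma_algebra.
apply: closed_openC; apply: accessible_closed_set1; apply: hausdorff_accessible.
exact: norm_hausdorff.
Qed.

Lemma cube_sub_bounded (A : set 'rV[R]_N) (p : 'rV[R]_N) (s : R) :
  A `<=` cube p s -> bounded_set A.
Proof.
move=> Ap; pose K := (\sum_i `|p ord0 i|) + `|s|.
have pK i : `|p ord0 i| <= \sum_i `|p ord0 i|.
  by rewrite (bigD1 i)//= lerDl sumr_ge0.
exists K; split; first exact: num_real.
move=> M KM y /Ap yp; rewrite /Num.norm /= mx_normrE.
apply: bigmax_le => [|[i j] _ /=].
  by apply: ltW; apply: le_lt_trans KM; rewrite addr_ge0// sumr_ge0.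
rewrite [i]ord1; have /andP[y1 y2] := yp j; have pj := pK j.
have := ler_norm s; have := ler_norm (p ord0 j); have := ler_norm (- p ord0 j).
rewrite normrN ler_norml /K in KM *; have := normr_ge0 s => *.
by apply/andP; split; lra.
Qed.

Section Atoms.
Variable mu : configuration R N.

Lemma cfg_atom_ge1 (x : 'rV[R]_N) : mu [set x] != 0%E -> (1 <= mu [set x])%E.
Proof.
have bx : bounded_set [set x].
  apply: (@cube_sub_bounded _ x 1) => _ -> i.
  by rewrite lexx ltrDl ltr01.
have [n ->] := cfg_integer mu (measurable_point x) bx.
by case: n => [|n]; rewrite ?eqxx// lee_fin ler1n.
Qed.

(** An integer-valued measure of mass 1 is a Dirac mass.  For each coordinate, the
    mass of the half-space below the level [t] jumps from 0 to 1 at a single level;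
    these levels are the coordinates of the atom. *)
Lemma cfg_atom (A : set E) (p : 'rV[R]_N) (s : R) : measurable A ->
  A `<=` cube p s -> mu A = 1%E -> exists2 x, A x & mu [set x] = 1%E.
Proof.
move=> mA Ap A1.
pose lt i t := A `&` [set x : 'rV[R]_N | x ord0 i < t].
pose ge i t := A `&` [set x : 'rV[R]_N | t <= x ord0 i].
have mlt i t : measurable (lt i t : set E).
  by apply: measurableI => //; exact: measurable_coord_lt.
have mge i t : measurable (ge i t : set E).
  by apply: measurableI => //; exact: measurable_coord_ge.
have bA : bounded_set (A : set 'rV[R]_N) by exact: cube_sub_bounded Ap.
have split_lt i t : (mu (lt i t) + mu (ge i t) = 1)%E.
  rewrite -A1 -measureU//; last first.
    by apply/seteqP; split => x // [[_ /= xt] [_ /=]]; rewrite leNgt xt.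
  congr (mu _); rewrite -setIUr; apply/seteqP; split => [x []//|x Ax].
  by split => //=; case: (ltP (x ord0 i) t); [left|right].
have lt01 i t : mu (lt i t) <> 0%E -> mu (ge i t) = 0%E.
  have bS B : bounded_set (A `&` B : set 'rV[R]_N).
    by apply: (@cube_sub_bounded _ p s) => x [/Ap].
  have [n nE] := cfg_integer mu (mlt i t) (bS _).
  have [m mE] := cfg_integer mu (mge i t) (bS _).
  have := split_lt i t; rewrite nE mE -EFinD => -[] /eqP.
  rewrite -natrD (@eqr_nat _ _ 1).
  by case: n m {nE mE} => [|[|n]] [|m] //.
have null_lt i t t' : t <= t' -> mu (lt i t') = 0%E -> mu (lt i t) = 0%E.
  move=> tt' lt0; apply/eqP; rewrite -measure_le0 -lt0 le_measure ?inE//.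
  by move=> x [Ax /= xt]; split => //=; exact: lt_le_trans tt'.
pose S i := [set t | mu (lt i t) = 0%E].
have Ssup i : has_sup (S i).
  split.
    exists (p ord0 i); rewrite /S /= (_ : lt i _ = set0) ?measure0//.
    by apply/seteqP; split => x // [/Ap /(_ i)/andP[px _]] /=; rewrite ltNge px.
  exists (p ord0 i + s) => t St; rewrite leNgt; apply/negP => pt.
  have := St; rewrite /S /= (_ : lt i t = A) ?A1; first by case=> /eqP; rewrite oner_eq0.
  apply/seteqP; split => x; first by case.
  by move=> Ax; split => //=; have /andP[_ /lt_trans] := Ap x Ax i; exact.
pose x : 'rV[R]_N := \row_i sup (S i).
have null1 i : mu (lt i (x ord0 i)) = 0%E.
  apply/negligibleP => //; rewrite (_ : lt _ _ = \bigcup_k lt i (x ord0 i - k.+1%:R^-1)).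
    apply: negligible_bigcup => k; apply/negligibleP => //.
    have [t St xt] := @sup_adherent _ (S i) k.+1%:R^-1 ltac:(by rewrite invr_gt0) (Ssup i).
    by apply: null_lt St; rewrite mxE ltW.
  apply/seteqP; split => y; last first.
    case=> k _ [Ay /= yk]; split => //=; apply: lt_trans yk _.
    by rewrite gtrBl invr_gt0.
  case=> Ay /= /ltr_add_invr[k yk]; exists k => //; split => //=.
  by rewrite ltrBrDr.
pose off i := A `&` [set y : 'rV[R]_N | y ord0 i != x ord0 i].
have null2 i : (cfg_measure mu).-negligible (off i).
  apply: (@negligibleS _ _ _ _ (lt i (x ord0 i) `|` \bigcup_k ge i (x ord0 i + k.+1%:R^-1))).
    move=> y [Ay /=]; case: ltgtP => // yx _; first by left.
    by right; have [k /ltW xk] := ltr_add_invr yx; exists k.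
  apply: negligibleU; first by apply/negligibleP => //; exact: null1.
  apply: negligible_bigcup => k; apply/negligibleP => //; apply: lt01 => xk0.
  have := ub_le_sup (Ssup i).2 xk0; rewrite mxE leNgt ltrDl invr_gt0.
  by rewrite ltr0Sn.
have offx : (cfg_measure mu).-negligible (A `\ x).
  apply: (@negligibleS _ _ _ _ (\bigcup_k (if insub k is Some i then off i else set0))).
    move=> y [Ay /= yx]; apply: contrapT => nk; apply: yx; apply/rowP => i.
    apply/eqP/negPn/negP => yxi; apply: nk; exists (nat_of_ord i) => //=.
    by rewrite valK.
  apply: negligible_bigcup => k; case: insubP => [i _ _|_]; first exact: null2.
  exact: negligible_set0.
have mx := measurable_point x.
have Ax0 : mu (A `\ x) = 0%E by apply/negligibleP => //; exact: measurableD.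
have AxE : mu (A `&` [set x]) = 1%E.
  have e : (mu A = mu (A `\ x) + mu (A `&` [set x]))%E := measureDI _ mA mx.
  by move: e; rewrite A1 Ax0 add0e.
have Ax : A x.
  apply: contrapT => nAx; have := AxE; rewrite (_ : _ `&` _ = set0) ?measure0.
    by case=> /eqP; rewrite eq_sym oner_eq0.
  by apply/seteqP; split => y // [Ay yx]; apply: nAx; rewrite -yx.
exists x => //; rewrite -AxE; congr (mu _).
by apply/seteqP; split => y; [move=> ->|case].
Qed.

Lemma cfg_null (A : set E) (x : 'rV[R]_N) : measurable A -> A x -> mu A = 0%E ->
  mu [set x] = 0%E.
Proof.
move=> mA Ax A0; apply/eqP; rewrite -measure_le0 -A0 le_measure ?inE//.
  exact: measurable_point.
by move=> _ ->.
Qed.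

(** Each atom has mass at least 1 and the total mass is finite.  Thus [points_in] is
    not the dummy value of [fset_set]. *)
Lemma points_in_finite (D : set E) : measurable D -> bounded_set (D : set 'rV[R]_N) ->
  finite_set [set x : 'rV[R]_N | D x /\ cfg_measure mu [set x] != 0%E].
Proof.
move=> mD bD; apply: contrapT => /infinite_set_fset inf.
have [n nE] := cfg_integer mu mD bD.
have [B BD nB] := inf n.+1.
have set_nilE : [set` [::] : seq 'rV[R]_N] = set0 by apply/seteqP; split => y.
have set_consE (x : 'rV[R]_N) s : [set` x :: s] = [set x] `|` [set` s].
  apply/seteqP; split => y /=; rewrite inE; first by case/orP => [/eqP|]; [left|right].
  by case=> [->|->]; rewrite ?eqxx ?orbT.
have mset (s : seq 'rV[R]_N) : measurable ([set` s] : set E).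
  elim: s => [|x s IH]; first by rewrite set_nilE; exact: measurable0.
  by rewrite set_consE; apply: measurableU => //; exact: measurable_point.
have size_le (s : seq 'rV[R]_N) : uniq s -> (forall x, x \in s -> (1 <= mu [set x])%E) ->
    ((size s)%:R%:E <= mu [set` s])%E.
  elim: s => [|x s IH] /=; first by rewrite set_nilE measure0.
  move=> /andP[xs us] s1; have mx := measurable_point x; have ms := mset s.
  rewrite set_consE measureU//; last first.
    by apply/seteqP; split => y // [-> /=]; rewrite (negPf xs).
  rewrite -nat1r EFinD leeD//; first by apply: s1; rewrite mem_head.
  by apply: IH => // y ys; apply: s1; rewrite inE ys orbT.
have : (#|` B|%:R%:E <= mu [set` B])%E.
  by apply: size_le => [|x xB]; [exact: fset_uniq|apply: cfg_atom_ge1; case: (BD x xB)].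
apply/negP; rewrite -ltNge; apply: (@le_lt_trans _ _ (mu D)).
  rewrite le_measure ?inE//; first exact: mset.
  by move=> x /BD[].
by rewrite nE lte_fin ltr_nat.
Qed.

Lemma mem_points_in (D : set E) (x : 'rV[R]_N) : measurable D ->
  bounded_set (D : set 'rV[R]_N) ->
  x \in points_in mu D <-> D x /\ mu [set x] != 0%E.
Proof.
move=> mD bD; rewrite /points_in in_fset_set; last exact: points_in_finite.
by rewrite inE.
Qed.

End Atoms.
End Borel.

(** * The event that a cell contains a copy of a point set *)

Section CopyEvent.
Variables (R : realType) (N : nat).
Local Notation E := (euclid R N).

Lemma boxE (l : R) : box (N := N) l = cube (const_mx (- (l / 2))) l.
Proof.
have e : - (l / 2) + l = l / 2 by lra.
by apply/seteqP; split => x xl i; have := xl i; rewrite mxE e.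
Qed.

Lemma measurable_box (l : R) : measurable (box l : set E).
Proof. by rewrite boxE; exact: measurable_cube. Qed.

Lemma bounded_box (l : R) : bounded_set (box (N := N) l).
Proof. by apply: (@cube_sub_bounded _ _ _ (const_mx (- (l / 2))) l); rewrite boxE. Qed.

Variables (Xi0 : {fset 'rV[R]_N}) (r l : R).

Definition spot (x : 'rV[R]_N) : set 'rV[R]_N := cube (x - const_mx r) (2 * r).

Lemma spotP x y : spot x y <-> forall i, x ord0 i - r <= y ord0 i < x ord0 i + r.
Proof.
have e c : c - r + 2 * r = c + r by lra.
by split => xy i; have := xy i; rewrite !mxE e.
Qed.

Definition emptied : set 'rV[R]_N :=
  box l `\` \bigcup_(x in [set` Xi0]) spot x.

(** This event depends on a bounded region and has positive Poisson probability;
    it forces the points of the cell to be a perturbed copy of [Xi0]. *)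
Definition copy_event : set (configuration R N) :=
  [set mu | (forall x, x \in Xi0 -> cfg_measure mu (spot x) = 1%E) /\
    cfg_measure mu emptied = 0%E].

Let xs := enum_fset Xi0.
(** The event prescribes the numbers of points of finitely many disjoint sets. *)
Let part (i : 'I_(size xs).+1) : set E :=
  if (i < size xs)%N then spot (nth 0 xs i) else emptied.
Let number (i : 'I_(size xs).+1) : nat := (i < size xs)%N.

Lemma measurable_emptied : measurable (emptied : set E).
Proof.
apply: measurableD; first exact: measurable_box.
apply: fin_bigcup_measurable; first exact: finite_fset.
by move=> x _; exact: measurable_cube.
Qed.

Let measurable_part i : measurable (part i).
Proof.
by rewrite /part; case: ifP => _; [exact: measurable_cube|exact: measurable_emptied].
Qed.

Let bounded_part i : bounded_set (part i : set 'rV[R]_N).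
Proof.
rewrite /part; case: ifP => _.
  by apply: cube_sub_bounded; exact: subset_refl.
by apply: (@cube_sub_bounded _ _ _ (const_mx (- (l / 2))) l); rewrite -boxE; exact: subDsetl.
Qed.

Let copy_eventE : copy_event = \bigcap_i count_event (part i) (number i).
Proof.
apply/seteqP; split => [mu [mu1 mu0] i _|mu muP].
  rewrite /count_event /part /number /=; case: ifP => ix; last exact: mu0.
  by apply: mu1; rewrite -[_ \in Xi0]/(_ \in xs) mem_nth.
split=> [x xX|].
  have xi : (index x xs < (size xs).+1)%N by rewrite ltnS index_size.
  have := muP (Ordinal xi) Logic.I; rewrite /count_event /part /number /=.
  by rewrite index_mem xX nth_index.
have := muP ord_max Logic.I; rewrite /count_event /part /number /=.
by rewrite ltnn.
Qed.

Lemma measurable_copy_event : measurable copy_event.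
Proof.
rewrite copy_eventE.
apply: (@fin_bigcap_measurable _ (configuration R N) _ setT
  (fun i => count_event (part i) (number i))) => [|i _]; first exact: finite_finset.
rewrite -[X in measurable X]setTI.
exact: (measurable_cfg_eval (measurable_part i) measurableT
  (emeasurable_set1 (number i)%:R%:E)).
Qed.

Hypothesis N_gt0 : (0 < N)%N.
Hypothesis r0 : 0 < r.
Hypothesis spot_disj : forall x y z, x \in Xi0 -> y \in Xi0 -> spot x z -> spot y z -> x = y.

Lemma poisson_copy_event (lambda : R) (Pi : probability (configuration R N) R) :
  0 < lambda -> poisson_law lambda Pi -> (0 < Pi copy_event)%E.
Proof.
move=> lambda0 [Pi1 Pi2].
have lastE (k : 'I_(size xs).+1) : (k < size xs)%N = false -> k = size xs :> nat.
  by move=> /negbT; rewrite -leqNgt => h; apply/eqP; rewrite eqn_leq h -ltnS ltn_ord.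
rewrite copy_eventE Pi2 //; last first.
  move=> i j _ _ [z []]; rewrite /part.
  case: ifP => ix; case: ifP => jx zi zj.
  - apply: val_inj; apply/eqP; rewrite -(nth_uniq 0 ix jx (fset_uniq _)); apply/eqP.
    by apply: spot_disj zi zj; apply: mem_nth.
  - by case: zj => _ []; exists (nth 0 xs i) => //=; apply: mem_nth.
  - by case: zi => _ []; exists (nth 0 xs j) => //=; apply: mem_nth.
  - exact: val_inj (etrans (lastE _ ix) (esym (lastE _ jx))).
elim/big_ind: _ => //= [x y|i _]; first exact: mule_gt0.
have -> := Pi1 _ (measurable_part i) (bounded_part i) (number i).
rewrite lte_fin /part /number; case: ifP => _; last first.
  by rewrite expr0 mulr1 fact0 divr1 expR_gt0.
rewrite expr1 divr1 mulr_gt0 ?expR_gt0// mulr_gt0//.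
by apply: volume_cube_gt0 => //; rewrite mulr_gt0.
Qed.

Hypothesis spot_box : forall x, x \in Xi0 -> spot x `<=` box l.

Lemma copy_event_restrict (D : set E) (mD : measurable D) : box l `<=` D ->
  cfg_restrict mD @^-1` copy_event = copy_event.
Proof.
move=> lD; have vD : emptied `&` D = emptied.
  by apply/setIidl; apply: subset_trans lD; exact: subDsetl.
have sD x : x \in Xi0 -> spot x `&` D = spot x.
  by move=> xX; apply/setIidl; apply: subset_trans lD; exact: spot_box.
have restrE mu A : cfg_measure (cfg_restrict mD mu) A = cfg_measure mu (A `&` D) by [].
apply/seteqP; split => mu [mu1 mu0]; split => [x xX|].
- by rewrite -(sD x xX) -restrE; exact: mu1.
- by rewrite -vD -restrE; exact: mu0.
- by rewrite restrE sD// mu1.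
- by rewrite restrE vD.
Qed.
End CopyEvent.

Section PositiveDensity.
Local Open Scope charge_scope.
Variables (d : measure_display) (T : measurableType d) (R : realType).
Variables (nu mu : probability T R).
Hypothesis ac : nu `<< mu.
Let dens := 'd (charge_of_finite_measure nu) '/d mu.
Hypothesis dens_gt0 : {ae mu, forall x, (0 < dens x)%E}.

(** If [nu B = 0], then the density vanishes almost everywhere on [B], which
    contradicts its positivity unless [mu B = 0]. *)
Lemma density_measure_gt0 (B : set T) : measurable B -> (0 < mu B)%E -> (0 < nu B)%E.
Proof.
move=> mB muB; rewrite lt0e measure_ge0 andbT; apply/eqP => nuB.
have ac' : charge_of_finite_measure nu `<< mu by [].
have mf : measurable_fun B dens.
  by apply: measurable_funTS; exact: measurable_int (Radon_Nikodym_integrable ac').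
have intB : (\int[mu]_(x in B) dens x = 0)%E.
  by rewrite -nuB; exact/esym/(Radon_Nikodym_integral ac' mB).
have : ae_eq mu B dens (cst 0%E).
  apply/ae_eq_integral_abs => //; rewrite -intB; apply: ae_eq_integral => //.
    exact: measurableT_comp.
  by apply: filterS dens_gt0 => x fx _; rewrite gee0_abs// ltW.
move=> f0; have : {ae mu, forall x, ~ B x}.
  apply: filterS2 f0 dens_gt0 => x /= fx f0x Bx.
  by move: f0x; rewrite fx// ltxx.
move=> [C [mC C0 BC]]; move: muB; rewrite lt0e => /andP[/eqP + _]; apply.
apply/eqP; rewrite -measure_le0 -C0 le_measure ?inE// => x Bx.
by apply: BC => /=; apply.
Qed.
End PositiveDensity.

Lemma density_event_gt0 (R : realType) (N : nat)
    (Theta Pi : probability (configuration R N) R) (D : set (euclid R N)) (mD : measurable D) :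
  distribution Theta (cfg_restrict mD) `<< distribution Pi (cfg_restrict mD) ->
  {ae distribution Pi (cfg_restrict mD), forall mu,
    (0 < restricted_density mD Theta Pi mu)%E} ->
  forall B : set (configuration R N), measurable B ->
  cfg_restrict mD @^-1` B = B -> (0 < Pi B)%E -> (0 < Theta B)%E.
Proof.
move=> ac dens B mB DB PiB.
have := density_measure_gt0 ac dens mB.
rewrite -[X in (0 < X -> _)%E]/(Pi (cfg_restrict mD @^-1` B)) DB => /(_ PiB).
by rewrite -[X in (0 < X)%E -> _]/(Theta (cfg_restrict mD @^-1` B)) DB.
Qed.

(** * A grid of cells *)

Section Euclidean.
Variables (R : realType) (N : nat).
Implicit Types (x y z v : 'rV[R]_N).

Lemma coord_le_enorm v i : `|v ord0 i| <= enorm v.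
Proof.
rewrite /enorm -sqrtr_sqr ler_wsqrtr// (bigD1 i)//= lerDl.
by apply: sumr_ge0 => j _; exact: sqr_ge0.
Qed.

Lemma enorm_le_coord v (r : R) : 0 <= r -> (forall i, `|v ord0 i| <= r) ->
  enorm v <= N.+1%:R * r.
Proof.
move=> r0 vr; have nr0 : 0 <= N.+1%:R * r by rewrite mulr_ge0.
rewrite /enorm -[leRHS](ger0_norm nr0) -sqrtr_sqr ler_wsqrtr//.
apply: (@le_trans _ _ (\sum_(i < N) r ^+ 2)).
  by apply: ler_sum => i _; rewrite -real_normK ?num_real// lerXn2r ?nnegrE.
rewrite sumr_const card_ord -[leLHS]mulr_natl exprMn ler_wpM2r ?sqr_ge0//.
by rewrite -natrX ler_nat expnS expn1 (leq_trans (leqnSn N))// leq_pmulr.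
Qed.

(** The cubes around the points of [Xi0] are so small that they are disjoint and of
    size at most [d], and the cell is so large that it contains them with a margin
    [M]. *)
Lemma spots_choice (Xi0 : {fset 'rV[R]_N}) (d M : R) : 0 < d -> 0 < M ->
  exists r l : R, [/\ 0 < r /\ 0 < l,
    forall x y z, x \in Xi0 -> y \in Xi0 -> spot r x z -> spot r y z -> x = y,
    forall x, x \in Xi0 -> spot r x `<=` box l,
    (forall x y : 'rV[R]_N, spot r x y -> enorm (y - x) <= d) &
    forall x y z, x \in Xi0 -> spot r x z -> ~ box l y -> M <= enorm (y - z)].
Proof.
move=> d0 M0.
(* Two distinct points of Xi0 have a coordinate that differs by at least m. *)
pose vals := [seq (val p.1.1) ord0 p.2 - (val p.1.2) ord0 p.2 | p : Xi0 * Xi0 * 'I_N].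
have [m m0 mP] := finite_gap vals 0.
pose r := Num.min (m / 2) (d / N.+1%:R).
have r0 : 0 < r by rewrite lt_min !divr_gt0.
have rm : 2 * r <= m by have : r <= m / 2 by [rewrite ge_min lexx]; lra.
have rd : N.+1%:R * r <= d.
  by rewrite mulrC -ler_pdivlMr// ge_min lexx orbT.
pose S := \sum_(x <- enum_fset Xi0) \sum_i `|x ord0 i|.
have SP x i : x \in Xi0 -> `|x ord0 i| <= S.
  move=> xX; rewrite /S (big_rem x)//= (bigD1 i)//= -addrA lerDl addr_ge0//.
    exact: sumr_ge0.
  by apply: sumr_ge0 => y _; exact: sumr_ge0.
have S0 : 0 <= S by apply: sumr_ge0 => y _; exact: sumr_ge0.
pose l := 2 * (S + r + M); exists r, l.
have spotS x y i : x \in Xi0 -> spot r x y -> - (S + r) <= y ord0 i < S + r.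
  move=> /(SP x i); rewrite ler_norml => /andP[x1 x2] /spotP/(_ i)/andP[y1 y2].
  by apply/andP; split; lra.
have l2 : l / 2 = S + r + M by rewrite /l; lra.
split=> //.
- by split; rewrite // /l; lra.
- move=> x y z xX yX /spotP xz /spotP yz; apply/rowP => i; apply/eqP/negPn/negP => xy.
  have : m <= `|x ord0 i - y ord0 i - 0|.
    apply: mP; last by rewrite subr_eq0.
    by apply/mapP; exists ([` xX]%fset, [` yX]%fset, i); rewrite // mem_enum.
  have /andP[x1 x2] := xz i; have /andP[y1 y2] := yz i.
  by rewrite subr0 ler_normr => /orP[]; lra.
- by move=> x xX y xy i; have /andP[y1 y2] := spotS x y i xX xy; rewrite l2; apply/andP; split; lra.
- move=> x y /spotP xy; apply: le_trans rd; apply: enorm_le_coord (ltW r0) _ => i.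
  by rewrite !mxE; have /andP[y1 y2] := xy i; rewrite ler_norml; apply/andP; split; lra.
- move=> x y z xX xz yl; rewrite leNgt; apply/negP => yzM; apply: yl => i.
  have := le_lt_trans (coord_le_enorm (y - z) i) yzM; rewrite !mxE l2.
  have /andP[z1 z2] := spotS x z i xX xz.
  by rewrite ltr_norml => /andP[w1 w2]; apply/andP; split; lra.
Qed.

End Euclidean.

Section Cells.
Variables (R : realType) (N : nat) (Xi0 : {fset 'rV[R]_N}) (r l d M : R).
Hypothesis spot_disj :
  forall x y z, x \in Xi0 -> y \in Xi0 -> spot r x z -> spot r y z -> x = y.
Hypothesis spot_box : forall x, x \in Xi0 -> spot r x `<=` box l.
Hypothesis spot_near : forall x y : 'rV[R]_N, spot r x y -> enorm (y - x) <= d.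
Hypothesis spot_far :
  forall x y z : 'rV[R]_N, x \in Xi0 -> spot r x z -> ~ box l y -> M <= enorm (y - z).
Variables (mu : configuration R N) (L : R).

Lemma cfg_shiftE (a : 'rV[R]_N) (A : set 'rV[R]_N) :
  cfg_measure (cfg_shift (- a) mu) A = cfg_measure mu [set y | A (y - a)].
Proof. by []. Qed.

(** Each cube has mass 1, hence contains exactly one atom: this is the copy of the
    corresponding point of [Xi0].  Any other atom lies outside the cell. *)
Lemma copies_of_event n (a : 'I_n -> 'rV[R]_N) :
  (forall j, copy_event Xi0 r l (cfg_shift (- a j) mu)) ->
  (forall j y, box l (y - a j) -> box L y) ->
  (forall j k y, box l (y - a j) -> box l (y - a k) -> j = k) ->
  exists g : 'I_n -> Xi0 -> points_in mu (box L), near_copies d M g.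
Proof.
move=> ev cellL cell_disj.
have mspot j x : measurable ([set y | spot r x (y - a j)] : set (euclid R N)).
  rewrite -[X in measurable X]setTI.
  exact: (measurable_shift_point (- a j) measurableT (measurable_cube _ _)).
have bspot j x : [set y | spot r x (y - a j)] `<=` cube (x + a j - const_mx r) (2 * r).
  move=> y xy i; have := xy i; rewrite !mxE => /andP[y1 y2]; apply/andP; split; lra.
have mpoints y : y \in points_in mu (box L) <-> box L y /\ cfg_measure mu [set y] != 0%E.
  by apply: mem_points_in; [exact: measurable_box|exact: bounded_box].
have spot1 j x : x \in Xi0 -> cfg_measure mu [set y | spot r x (y - a j)] = 1%E.
  by move=> xX; rewrite -cfg_shiftE; exact: (ev j).1.
have atom j (x : Xi0) : exists y : points_in mu (box L), spot r (val x) (val y - a j).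
  have [y xy y1] := cfg_atom (mspot j (val x)) (@bspot j (val x)) (spot1 j _ (fsvalP x)).
  have yL : y \in points_in mu (box L).
    apply/mpoints; split; last by rewrite y1 oner_neq0.
    by apply: (cellL j); apply: spot_box xy; exact: fsvalP.
  by exists [` yL]%fset.
have /(@boolp.choice _ _)[g0 g0P] : forall p : 'I_n * Xi0, exists y : points_in mu (box L),
    spot r (val p.2) (val y - a p.1).
  by case=> j x; exact: atom.
pose g j x := g0 (j, x); have gP j x : spot r (val x) (val (g j x) - a j) := g0P (j, x).
exists g; split.
- move=> j x x' gxx'; apply: val_inj; apply: (spot_disj (fsvalP x) (fsvalP x') (gP j x)).
  by rewrite gxx'; exact: gP.
- move=> j k x y jk; apply: contraNneq jk => gxy; apply/eqP.
  apply: (@cell_disj _ _ (val (g j x))); first by apply: spot_box (gP j x); exact: fsvalP.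
  by rewrite gxy; apply: spot_box (gP k y); exact: fsvalP.
- move=> j; exists (a j) => x; rewrite opprD addrCA addrC.
  by have := spot_near (gP j x); rewrite -addrA [- _ + _]addrC addrA.
- move=> j x y yg.
  have -> : val y - val (g j x) = (val y - a j) - (val (g j x) - a j).
    by rewrite opprB addrA subrK.
  apply: (spot_far (fsvalP x) (gP j x)) => yl.
  have [yL y0] := (mpoints (val y)).1 (fsvalP y).
  have [[x' x'X x'y]|nx] := pselect (exists2 x', x' \in Xi0 & spot r x' (val y - a j)); last first.
    have := (ev j).2; rewrite cfg_shiftE => emptied0.
    have yv : emptied Xi0 r l (val y - a j).
      by split => // -[x' x'X x'y]; apply: nx; exists x'.
    have mv : measurable ([set y | emptied Xi0 r l (y - a j)] : set (euclid R N)).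
      rewrite -[X in measurable X]setTI.
      exact: (measurable_shift_point (- a j) measurableT (measurable_emptied _ _ _)).
    by have := y0; rewrite (cfg_null mv yv emptied0) eqxx.
  have := yg [` x'X]%fset; apply/negP/negPn/eqP.
  set y' := g j _; apply: contrapT => y'y.
  have y'P : spot r x' (val y' - a j) := gP j [` x'X]%fset.
  have := spot1 j _ x'X.
  have [_ y'0] := (mpoints (val y')).1 (fsvalP y').
  have : (cfg_measure mu ([set val y] `|` [set val y']) <= cfg_measure mu [set z | spot r x' (z - a j)%R])%E.
    rewrite le_measure ?inE//; first by apply: measurableU; exact: measurable_point.
    by move=> z [->|->].
  rewrite measureU//; [|exact: measurable_point|exact: measurable_point|]; last first.
    by apply/seteqP; split => z // [-> /= /val_inj yy']; case: y'y.
  move=> /[swap] -> ; apply/negP; rewrite -ltNge.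
  have := leeD (cfg_atom_ge1 y0) (cfg_atom_ge1 y'0).
  by apply: lt_le_trans; rewrite -EFinD lte_fin; lra.
Qed.

End Cells.

Section Grid.
Variables (R : realType) (N : nat) (l L : R).
Hypotheses (l0 : 0 < l) (lL : l <= L).

(** The largest grid of translates of the cell of side [l] that is aligned with a
    corner of the box of side [L]. *)
Definition grid_size := Num.truncn (L / l).

Definition grid_center (k : {ffun 'I_N -> 'I_grid_size}) : 'rV[R]_N :=
  \row_i (- (L / 2) + l * (k i)%:R + l / 2).

Lemma grid_cellP k y : box l (y - grid_center k) <->
  forall i, - (L / 2) + l * (k i)%:R <= y ord0 i < - (L / 2) + l * (k i).+1%:R.
Proof.
have e (i : 'I_N) : l * (k i).+1%:R = l * (k i)%:R + l by rewrite -natr1 mulrDr mulr1.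
split=> yk i; have := yk i; rewrite !mxE ?e => /andP[y1 y2]; apply/andP; split; lra.
Qed.

Lemma grid_cell_box k y : box l (y - grid_center k) -> box L y.
Proof.
move=> /grid_cellP yk i; have /andP[y1 y2] := yk i.
have k0 : 0 <= l * (k i)%:R by rewrite mulr_ge0// ltW.
have kL : l * (k i).+1%:R <= L.
  rewrite mulrC -ler_pdivlMr//; apply: (@le_trans _ _ grid_size%:R).
    by rewrite ler_nat.
  by rewrite truncn_le// divr_ge0// ltW// (lt_le_trans l0).
by apply/andP; split; lra.
Qed.

Lemma grid_cell_disj k k' y :
  box l (y - grid_center k) -> box l (y - grid_center k') -> k = k'.
Proof.
move=> /grid_cellP yk /grid_cellP yk'; apply/ffunP => i; apply: val_inj => /=.
have lt_cell (m m' : nat) : - (L / 2) + l * m%:R <= y ord0 i ->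
    y ord0 i < - (L / 2) + l * m'.+1%:R -> (m <= m')%N.
  move=> ym ym'; rewrite -ltnS -(ltr_nat R) -(ltr_pM2l l0); lra.
have /andP[y1 y2] := yk i; have /andP[y1' y2'] := yk' i.
by apply/eqP; rewrite eqn_leq (lt_cell _ _ y1 y2') (lt_cell _ _ y1' y2).
Qed.

(** The number of cells is of the order of the volume of the box: the integer part
    of [L / l] is at least [L / (2 l)]. *)
Lemma grid_count : ((2 * l) ^- N <= L ^- N * (#|{ffun 'I_N -> 'I_grid_size}|)%:R)%R.
Proof.
have L0 : 0 < L by exact: lt_le_trans lL.
rewrite card_ffun !card_ord natrX -!exprVn -exprMn.
rewrite lerXn2r ?nnegrE ?mulr_ge0 ?invr_ge0 ?mulr_ge0 ?(ltW l0) ?(ltW L0)//.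
have Ll1 : 1 <= L / l by rewrite ler_pdivlMr// mul1r.
have /andP[g1 g2] := @truncn_itv _ (L / l) (le_trans ler01 Ll1).
have g3 : 1 <= grid_size%:R :> R.
  by rewrite ler1n; rewrite -ltnS -(ltr_nat R); apply: le_lt_trans Ll1 g2.
rewrite -/grid_size -[in X in _ < X]natr1 in g2.
have gL : L / l <= 2 * grid_size%:R by lra.
rewrite invfM -(ler_pM2l L0) mulVKf ?lt0r_neq0//.
by rewrite mulrCA; lra.
Qed.

End Grid.

(** * Integrals against set functions *)

(** The scaled intensity is a set function and not a priori a measure.  The integral
    of a nonnegative function against it is the supremum of the integrals of the
    simple functions below it, which gives the two estimates of this section. *)
Section SetFunctionIntegral.
Import HBNNSimple.
Local Open Scope ereal_scope.
Variables (d : measure_display) (T : measurableType d) (R : realType).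
Variables (m : set T -> \bar R).
Implicit Types (f : T -> \bar R) (h : {nnsfun T >-> R}).

Lemma sintegral_set0 h : (forall r : R, (0 < r)%R -> m (h @^-1` [set r]) = 0) ->
  m set0 = 0 -> sintegral m h = 0.
Proof.
move=> mr m0; rewrite /sintegral fsbig1// => r _.
have [r0|r0|->] := ltgtP r 0%R; last by rewrite mul0e.
- rewrite (_ : _ @^-1` _ = set0) ?m0 ?mule0//; apply/seteqP; split => // x /= hx.
  by have : (0 <= h x)%R := fun_ge0 x; rewrite hx leNgt r0.
- by rewrite mr// mule0.
Qed.

Lemma ge0_integral_sup f : m set0 = 0 -> (forall x, 0 <= f x) ->
  \int[m]_x f x =
  ereal_sup [set sintegral m h | h in [set h : {nnsfun T >-> R} | forall x, (h x)%:E <= f x]].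
Proof.
move=> m0 f0; rewrite /integral patch_setT.
have -> : f ^\+ = f by apply/funext => x; rewrite (@ge0_funeposE _ _ setT)// inE.
have -> : f ^\- = cst 0.
  by apply/funext => x; rewrite (@ge0_funenegE _ _ setT)// inE.
suff -> : ereal_sup [set sintegral m h | h in
    [set h : {nnsfun T >-> R} | forall x, (h x)%:E <= cst 0 x]] = 0 by rewrite sube0.
have -> : [set sintegral m h | h in
    [set h : {nnsfun T >-> R} | forall x, (h x)%:E <= cst 0 x]] = [set 0].
  have h0 h : (forall x, (h x)%:E <= 0) -> sintegral m h = 0.
    move=> hx; apply: sintegral_set0 => // r r0.
    rewrite (_ : _ @^-1` _ = set0)//; apply/seteqP; split => // x /= hxr.
    by have := hx x; rewrite hxr lee_fin leNgt r0.
  apply/seteqP; split => [_ [h hx <-]|_ ->] /=; first exact: h0.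
  exists nnsfun0; last by apply: h0 => x; exact: lexx.
  by move=> x; exact: lexx.
exact: ereal_sup1.
Qed.

Lemma integral_eq0_of_null f (S : set T) : (forall x, 0 <= f x) ->
  (forall x, f x != 0 -> S x) -> (forall B, measurable B -> B `<=` S -> m B = 0) ->
  \int[m]_x f x = 0.
Proof.
move=> f0 fS mS; have m0 : m set0 = 0 by exact: mS.
rewrite ge0_integral_sup//; apply/eqP; rewrite eq_le; apply/andP; split; last first.
  apply: ereal_sup_ubound; exists nnsfun0; first by move=> x; exact: f0.
  by apply: sintegral_set0 => // r r0; apply: mS => // x /= x0; move: r0; rewrite -x0 ltxx.
apply: ge_ereal_sup => _ [h hf <-]; rewrite sintegral_set0// => r r0.
apply: mS => // x /= hx; apply: fS; rewrite gt_eqF//.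
by apply: lt_le_trans (hf x); rewrite hx lte_fin.
Qed.

Lemma integral_ge_measure f (B : set T) : m set0 = 0 -> (forall x, 0 <= f x) ->
  measurable B -> (forall x, B x -> 1 <= f x) -> m B <= \int[m]_x f x.
Proof.
move=> m0 f0 mB Bf; rewrite ge0_integral_sup//; apply: ereal_sup_ubound.
exists (indic_nnsfun R mB) => /= [x|].
  rewrite mindicE; case: (boolP (x \in B)) => [|_]; last exact: f0.
  by rewrite inE; exact: Bf.
rewrite /sintegral -(@fsbig_widen _ _ _ _ [set 1%R])//=; last first.
  move=> r [_ /= r1]; have [->|r0] := eqVneq r 0%R; first by rewrite mul0e.
  rewrite (_ : _ @^-1` _ = set0) ?m0 ?mule0//; apply/seteqP; split => // x /=.
  by rewrite mindicE; case: (x \in B) => xr; [exact: r1|move: r0; rewrite -xr eqxx].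
rewrite fsbig_set1 mul1e; congr m; apply/seteqP; split => x /=; rewrite mindicE.
  by case: (boolP (x \in B)) => [/set_mem//|_ /eqP]; rewrite eq_sym oner_eq0.
by move=> Bx; rewrite mem_set.
Qed.

End SetFunctionIntegral.

(** As a supremum over simple functions, the integral is monotone on arbitrary
    nonnegative functions, such as the diagram measure of a random configuration. *)
Lemma le_integral_nonmeasurable (d : measure_display) (T : measurableType d) (R : realType)
  (mu : {measure set T -> \bar R}) (f g : T -> \bar R) :
  (forall x, 0 <= f x)%E -> (forall x, f x <= g x)%E ->
  (\int[mu]_x f x <= \int[mu]_x g x)%E.
Proof.
move=> f0 fg; have g0 x : (0 <= g x)%E by exact: le_trans (fg x).
rewrite !ge0_integralTE//; apply: ereal_sup_le => _ [h hf <-].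
by exists h => // x; exact: le_trans (fg x).
Qed.

Section Plane.
Variable R : realType.
Local Notation plane := (\bar R * \bar R)%type.

Lemma contract_continuous : continuous (@contract R).
Proof.
move=> x; apply/cvgrPdist_lt => e e0.
exact: (nbhsx_ballx x e e0).
Qed.

(** The extended line is the image of [[-1, 1]] under [expand]. *)
Lemma compact_ereal : compact [set: \bar R].
Proof.
have -> : [set: \bar R] = [set expand x | x in `[-1, 1]%classic].
  apply/seteqP; split => // x _; exists (contract x); last exact: contractK.
  by rewrite /= in_itv /= -ler_norml contract_le1.
apply: continuous_compact; last exact: segment_compact.
apply/subspace_continuousP => x /=; rewrite in_itv /= -ler_norml => x1.
apply/cvg_ballP => e e0; near=> y.
have y1 : `|y| <= 1.
  have : y \in `[-1, 1] by near: y; exact: withinT.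
  by rewrite in_itv /= -ler_norml.
change (is_true (`|contract (expand x) - contract (expand y)| < e)).
rewrite !expandK ?inE//; near: y; apply: cvg_within; exact: (nbhsx_ballx x e e0).
Unshelve. all: by end_near.
Qed.
End Plane.

(** * Bump functions on the extended plane *)

Section Plane.
Variable R : realType.
Local Notation plane := (\bar R * \bar R)%type.

Lemma measurable_open_ereal (U : set (\bar R)) : open U -> measurable U.
Proof.
move=> oU.
have -> : U = EFin @` (EFin @^-1` U) `|` ((U `&` [set +oo%E]) `|` (U `&` [set -oo%E])).
  apply/seteqP; split => [[r||] Ux|x [[r Ur <-]//|[[]//|[]//]]].
  - by left; exists r.
  - by right; left.
  - by right; right.
have mI (x : \bar R) : measurable (U `&` [set x]).
  have [Ux|nUx] := pselect (U x).
    by rewrite (_ : _ `&` _ = [set x]) //; apply/seteqP; split => y; [case|move=> ->].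
  by rewrite (_ : _ `&` _ = set0) //; apply/seteqP; split => y // [Uy yx]; apply: nUx; rewrite -yx.
apply: measurableU; last exact: measurableU.
apply: measurable_image_EFin; apply: open_measurable.
by apply: open_comp oU => r _ A.
Qed.

(** A compact pseudometric space has a countable base, so that an open set of the
    plane is a countable union of products of open sets. *)
Lemma measurable_open_plane (U : set plane) : open U -> measurable U.
Proof.
move=> oU; have [B cB [Bo Bb]] : @second_countable (\bar R).
  exact: (@compact_second_countable R (\bar R) (@compact_ereal R)).
pose P (i : set (\bar R) * set (\bar R)) := B i.1 /\ B i.2 /\ i.1 `*` i.2 `<=` U.
have cP : countable [set i | P i].
  apply: (@sub_countable _ _ _ (B `*` B)); last exact: countableX.
  by apply: subset_card_le => -[a b] [/= Ba [Bb' _]].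
have -> : U = \bigcup_(i in [set i | P i]) (i.1 `*` i.2).
  apply/seteqP; split => [[x y] Uxy|x [i [_ [_ iU]] ix]]; last exact: iU.
  have : nbhs (x, y) U by exact: open_nbhs_nbhs.
  case=> -[A1 A2] /= [A1x A2y] A12.
  have [C1 [BC1 C1x] C1A] := Bb x _ A1x.
  have [C2 [BC2 C2x] C2A] := Bb y _ A2y.
  exists (C1, C2) => //=; split => //; split => //.
  by move=> z [z1 z2]; apply: A12; split; [exact: C1A|exact: C2A].
have mP i : P i -> measurable (i.1 `*` i.2).
  case=> Bi1 [Bi2 _].
  exact: measurableX (measurable_open_ereal (Bo _ Bi1)) (measurable_open_ereal (Bo _ Bi2)).
have /pfcard_geP[->|[g]] := cP; first by rewrite bigcup_set0; exact: measurable0.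
have gP : forall n, P (g n) := fun n => @funS _ _ _ _ g n Logic.I.
rewrite (_ : \bigcup_(_ in _) _ = \bigcup_n ((g n).1 `*` (g n).2)).
  by apply: bigcupT_measurable => n; exact: (mP _ (gP n)).
apply/seteqP; split => [x [i Pi ix]|x [n _ ix]].
  by have [n _ ni] := surj (f := g) Pi; exists n; rewrite // ni.
by exists (g n) => //; exact: gP.
Qed.

Lemma measurable_Delta : measurable (Delta (R := R)).
Proof.
rewrite (_ : @Delta R = [set p : plane | (cst 0 p <= p.1)%E] `&` [set p | (p.1 < p.2)%E]); last by [].
rewrite -[X in measurable (X `&` _)]setTI -[X in measurable (_ `&` X)]setTI.
apply: measurableI.
  by apply: measurable_lee.
exact: measurable_lte.
Qed.

(** A truncated function of the distance to [p], in the coordinates [contract] that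
    identify the extended line with [[-1, 1]]. *)
Lemma bump_function (p : plane) (U : set plane) : Delta p -> open U -> U p ->
  exists f : plane -> R, [/\ Cc_Delta f, forall x, 0 <= f x,
    forall x, f x != 0 -> (U `&` Delta (R := R)) x &
    exists2 V : set plane, open V & V p /\ forall x, Delta x -> V x -> f x = 1].
Proof.
move=> [p0 p12] oU Up.
have : nbhs p U by exact: open_nbhs_nbhs.
move=> /nbhs_ballP[e /= e0 eU].
have cp12 : contract p.1 < contract p.2 by rewrite lt_contract.
pose D (x : plane) : R := Num.max `|contract p.1 - contract x.1| `|contract p.2 - contract x.2|.
(* The support is the ball of radius 2 ep: it stays in U and off the diagonal. *)
pose ep := Num.min e (contract p.2 - contract p.1) / 8.
have min0 : 0 < Num.min e (contract p.2 - contract p.1) by rewrite lt_min e0 subr_gt0.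
have ep0 : 0 < ep by rewrite divr_gt0.
have epe : 8 * ep <= e by rewrite mulrC divfK// ge_min lexx.
have epc : 8 * ep <= contract p.2 - contract p.1 by rewrite mulrC divfK// ge_min lexx orbT.
have distc (h : plane -> \bar R) (a : R) :
    continuous h -> continuous (fun x => `|a - contract (h x)| : R).
  move=> hc x; apply: cvg_norm; apply: cvgB; first exact: cvg_cst.
  by apply: continuous_comp; [exact: hc|exact: contract_continuous].
have Dc : continuous D.
  move=> x; apply: (@continuous_max R plane _ _ x (distc fst _ _ x) (distc snd _ _ x)).
    by move=> y; exact: cvg_fst.
  by move=> y; exact: cvg_snd.
pose g (x : plane) : R := Num.min 1 (Num.max 0 (2 - D x / ep)).
have gc : continuous g.
  move=> x; apply: (@continuous_min R plane (fun=> 1)); first exact: cvg_cst.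
  apply: (@continuous_max R plane (fun=> 0)); first exact: cvg_cst.
  apply: cvgB; first exact: cvg_cst.
  by apply: cvgM; [exact: Dc|exact: cvg_cst].
pose f (x : plane) : R := if (0 <= x.1)%E then g x else 0.
have gf x : Delta x -> g x = f x by case=> x0 _; rewrite /f x0.
have f_neq0 x : f x != 0 -> (0 <= x.1)%E /\ D x <= 2 * ep.
  rewrite /f; case: ifP => [_|]; last by rewrite eqxx.
  move=> gx; split=> //; rewrite leNgt; apply: contraNN gx => Dx.
  have h : 2 - D x / ep <= 0 by rewrite subr_le0 ler_pdivlMr// ltW.
  by rewrite /g (max_idPl h); apply/eqP/min_idPr.
have KU : [set x : plane | (0 <= x.1)%E /\ D x <= 2 * ep] `<=` U `&` Delta (R := R).
  move=> x /= [x0]; rewrite ge_max => /andP[D1 D2].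
  have e2 : 2 * ep < e by lra.
  split; first by apply: eU; split; [exact: le_lt_trans D1 e2|exact: le_lt_trans D2 e2].
  split=> //; rewrite -lt_contract.
  by move: D1 D2; rewrite !ler_norml => /andP[? ?] /andP[? ?]; lra.
exists f; split.
- split.
    apply: (@subspace_eq_continuous _ _ _ g); last exact: continuous_subspaceT.
    by move=> x /set_mem; exact: gf.
  exists [set x : plane | (0 <= x.1)%E /\ D x <= 2 * ep]; split.
  + apply: (@subclosed_compact _ _ [set: plane]) => //.
      apply: closedI.
        apply: (closed_comp (f := fst) (D := [set y : \bar R | (0 <= y)%E])).
          by move=> x _; exact: cvg_fst.
        exact: closed_ereal_le_ereal.
      apply: (closed_comp (f := D) (D := [set y : R | y <= 2 * ep])).
        by move=> x _; exact: Dc.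
      exact: closed_le.
    rewrite -setXTT; exact: compact_setX (@compact_ereal R) (@compact_ereal R).
  + by move=> x /KU[].
  + by move=> x nKx; apply/eqP; apply: contrapT => /negP/f_neq0.
- move=> x; rewrite /f; case: ifP => // _.
  by rewrite /g le_min ler01 le_max lexx.
- by move=> x /f_neq0/KU.
exists [set x | D x < ep].
  apply: (open_comp (f := D) (D := [set y : R | y < ep])).
    by move=> x _; exact: Dc.
  exact: open_lt.
split; first by rewrite /= /D !subrr normr0 maxxx.
move=> x [x0 _] /= Dx; rewrite /f x0 /g.
have h : 1 <= 2 - D x / ep by have : D x / ep < 1 by [rewrite ltr_pdivrMr// mul1r]; lra.
by apply/min_idPl; rewrite le_max h orbT.
Qed.
End Plane.

(** * Lower bound on the scaled intensity *)

Lemma measurable_cfg_shift (R : realType) (N : nat) (a : 'rV[R]_N) :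
  measurable_fun [set: configuration R N] (cfg_shift a).
Proof.
apply: measurable_to_configuration => A mA.
rewrite -[X in measurable_fun _ X]/(fun mu : configuration R N => cfg_measure mu (shift_point a @^-1` A)).
apply: measurable_cfg_eval; rewrite -[X in measurable X]setTI.
exact: measurable_shift_point.
Qed.

Section Intensity.
Variables (R : realType) (N q : nat) (F : fieldType).
Variables (kappa : {fset 'rV[R]_N} -> \bar R).
Variables (d : measure_display) (Omega : measurableType d) (P : probability Omega R).
Variables (Phi : {mfun Omega >-> configuration R N}).
Hypothesis Phi_stationary : stationary P Phi.

Lemma scaled_intensity_set0 (L : R) : scaled_intensity P Phi kappa F q L set0 = 0%E.
Proof.
rewrite /scaled_intensity (_ : (fun w => _) = cst 0%E) ?integral0 ?mule0//.
by apply/funext => w; apply: xi_eq0 => p _ [].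
Qed.

Variables (Xi0 : {fset 'rV[R]_N}) (r l dist M : R) (A : set (\bar R * \bar R)).
Hypothesis l0 : 0 < l.
Hypothesis copiesA : forall (Xi : {fset 'rV[R]_N}) n (g : 'I_n -> Xi0 -> Xi),
  near_copies dist M g -> (n%:R%:E <= xi kappa F q Xi A)%E.
Hypothesis eventP : forall (mu : configuration R N) L n (a : 'I_n -> 'rV[R]_N),
  (forall j, copy_event Xi0 r l (cfg_shift (- a j) mu)) ->
  (forall j y, box l (y - a j) -> box L y) ->
  (forall j k y, box l (y - a j) -> box l (y - a k) -> j = k) ->
  exists g : 'I_n -> Xi0 -> points_in mu (box L), near_copies dist M g.

(** The diagram of the configuration in the box charges [A] at least once for each
    cell of the grid where the translated event occurs; by stationarity, each cell
    contributes the same probability to the expectation. *)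
Lemma scaled_intensity_ge (L : R) : l <= L ->
  (((2 * l) ^- N)%:E * distribution P Phi (copy_event Xi0 r l) <=
    scaled_intensity P Phi kappa F q L A)%E.
Proof.
move=> lL; pose T := {ffun 'I_N -> 'I_(grid_size l L)}.
pose a (k : T) := grid_center k.
pose E (k : T) := Phi @^-1` (cfg_shift (- a k) @^-1` copy_event Xi0 r l).
have mC := measurable_copy_event Xi0 r l.
have mE k : measurable (E k).
  have mS : measurable (cfg_shift (- a k) @^-1` copy_event Xi0 r l).
    by rewrite -[X in measurable X]setTI; exact: (@measurable_cfg_shift R N (- a k) measurableT _ mC).
  have mPhi : measurable_fun [set: Omega] Phi by [].
  by rewrite -[E k]setTI; exact: (mPhi measurableT _ mS).
have PE k : P (E k) = distribution P Phi (copy_event Xi0 r l).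
  exact: Phi_stationary.
pose G w : \bar R := (\sum_(k : T) (\1_(E k) w)%:E)%E.
have G_le w : (G w <= xi kappa F q (points_in (Phi w) (box L)) A)%E.
  pose J := [set k : T | `[< E k w >]]%SET.
  have -> : G w = (#|J|%:R)%:E.
    rewrite /G -sum1_card natr_sum -sumEFin [RHS]big_mkcond; apply: eq_bigr => k _.
    rewrite indicE inE; case: asboolP => Ek; first by rewrite mem_set.
    by rewrite memNset.
  pose b (j : 'I_#|J|) := a (enum_val j).
  have [||j k y yj yk|g] := @eventP (Phi w) L #|J| b.
  - by move=> j; have := enum_valP j; rewrite inE => /asboolP.
  - by move=> j y; exact: grid_cell_box.
  - by apply: enum_val_inj; exact: grid_cell_disj yj yk.
  - exact: copiesA.
have intG : (\int[P]_w G w = (#|T|%:R)%:E * distribution P Phi (copy_event Xi0 r l))%E.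
  rewrite ge0_integral_sum//; last first.
    by move=> k; apply/measurable_EFinP; exact: measurable_indic.
  rewrite (eq_bigr (fun=> distribution P Phi (copy_event Xi0 r l))).
    rewrite big_const; elim: #|_| => [|n IH] /=; first by rewrite mul0e.
    by rewrite IH -nat1r EFinD ge0_muleDl ?mul1e ?lee_fin.
  by move=> k _; rewrite integral_indic// setIT; exact: PE.
apply: (@le_trans _ _ ((L ^- N)%:E * \int[P]_w G w)%E); last first.
  rewrite lee_wpmul2l//; first by rewrite lee_fin invr_ge0 exprn_ge0// (le_trans (ltW l0)).
  apply: le_integral_nonmeasurable => // w.
  by apply: sume_ge0 => k _; rewrite lee_fin.
rewrite intG muleA lee_wpmul2r//.
by rewrite -EFinM lee_fin; exact: grid_count.
Qed.

End Intensity.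

(** * The two inclusions *)

Section Support.
Variables (R : realType) (N q : nat) (N_gt0 : (0 < N)%N) (F : fieldType).
Variables (kappa : {fset 'rV[R]_N} -> \bar R) (kappaP : filtration_function kappa).
Variables (d : measure_display) (Omega : measurableType d) (P : probability Omega R).
Variable Phi : {mfun Omega >-> configuration R N}.
Local Notation plane := (\bar R * \bar R)%type.

(** A point of a diagram is realizable by definition; the empty configuration has an
    empty diagram. *)
Lemma scaled_intensity_eq0 (L : R) (B : set plane) :
  B `<=` Delta (R := R) -> (forall p, realizable kappa F q p -> ~ B p) ->
  scaled_intensity P Phi kappa F q L B = 0%E.
Proof.
move=> BD Br; rewrite /scaled_intensity (_ : (fun w => _) = cst 0%E) ?integral0 ?mule0//.
apply/funext => w; have [->|Xi0] := eqVneq (points_in (Phi w) (box L)) fset0.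
  exact: xi_fset0.
apply: xi_eq0 => p pd Bp; apply: (Br p) => //; split; first exact: BD.
exists (points_in (Phi w) (box L)) => //.
apply: (le_trans _ (diagram_measure_ge (P := pred1 p) _)).
  by rewrite lee_fin ler1n -has_count has_pred1.
by move=> r _ /eqP.
Qed.

(** Around a point outside the closure, a bump function has zero integral against
    all the scaled intensities, hence against their limit. *)
Lemma support_subset (nu : {measure set plane -> \bar R})
  (nu_limit : vague_limit (scaled_intensity P Phi kappa F q) nu) :
  support_in_Delta nu `<=` closure_in_Delta (realizable kappa F q).
Proof.
move=> p [pD pnu]; split=> //; apply: contrapT => ncl.
have [U [oU Up] Ur] : exists2 U, open U /\ U p & forall x, realizable kappa F q x -> ~ U x.
  apply: contrapT => nU; apply: ncl => B; rewrite nbhsE => -[U [oU Up] UB].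
  apply: contrapT => nrB; apply: nU; exists U => // x xr Ux.
  by apply: nrB; exists x; split => //; exact: UB.
have [f [fC f0 fU [V oV [Vp Vf]]]] := bump_function pD oU Up.
have intL L : (\int[scaled_intensity P Phi kappa F q L]_x (f x)%:E = 0)%E.
  apply: (@integral_eq0_of_null _ _ _ _ _ (U `&` Delta (R := R))) => [x|x|B _ BU].
  - by rewrite lee_fin.
  - by rewrite eqe => /fU.
  - by apply: scaled_intensity_eq0 => [x /BU[]//|x xr /BU[Ux _]]; exact: Ur Ux.
have intnu : (\int[nu]_x (f x)%:E = 0)%E.
  have := nu_limit f fC.
  rewrite (_ : (fun L : R => _) = cst 0%E); last exact/funext.
  by move=> /(cvg_unique (@ereal_hausdorff R) (cvg_cst _)).
have := pnu V oV Vp; rewrite ltNge => /negP; apply.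
have mV : measurable (V `&` Delta (R := R)).
  by apply: measurableI; [exact: measurable_open_plane|exact: measurable_Delta].
rewrite -intnu; apply: integral_ge_measure => //; last by move=> x [Vx Dx]; rewrite Vf.
Qed.

(** Around a realizable point, the integral of a bump function against the scaled
    intensity of side [L] is bounded below by a positive constant [c] for large [L],
    so that its integral against the limit cannot vanish. *)
Lemma closure_subset (nu : {measure set plane -> \bar R})
  (Phi_stationary : stationary P Phi)
  (lambda : R) (lambda_gt0 : 0 < lambda)
  (Pi : probability (configuration R N) R) (PiP : poisson_law lambda Pi)
  (Theta_abs_cont : forall (D : set (euclid R N)) (mD : measurable D),
    compact (D : set 'rV[R]_N) ->
    distribution (distribution P Phi) (cfg_restrict mD)
      `<< distribution Pi (cfg_restrict mD))
  (density_gt0 : forall (D : set (euclid R N)) (mD : measurable D),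
    compact (D : set 'rV[R]_N) ->
    {ae distribution Pi (cfg_restrict mD), forall mu,
      (0 < restricted_density mD (distribution P Phi) Pi mu)%E})
  (kappa_lip : hausdorff_lipschitz kappa)
  (nu_limit : vague_limit (scaled_intensity P Phi kappa F q) nu) :
  closure_in_Delta (realizable kappa F q) `<=` support_in_Delta nu.
Proof.
move=> p [pcl pD]; split=> // U oU Up.
have [[b' d'] [pr Upr]] := pcl U (open_nbhs_nbhs (conj oU Up)).
have [/= b0 bd] := pr.1.
have [b bE] : exists b : R, b' = b%:E.
  case: b' b0 bd {pr Upr} => [b _ _|_|//]; first by exists b.
  by rewrite ltNge leey.
subst b'.
have [f [fC f0 fU [V oV [Vp Vf]]]] := bump_function pr.1 oU Upr.
have [e [T [e0 near1]]] : exists e T : R, 0 < e /\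
    (forall x : R, `|b - x| < e -> forall y, match d' with
      | EFin d => exists2 y', y = y'%:E & `|d - y'| < e
      | _ => (T%:E < y)%E end -> V (x%:E, y)).
  have : nbhs (b%:E, d') V by exact: open_nbhs_nbhs.
  case=> -[A1 A2] /= [A1b A2d] A12.
  have /nbhs_ballP[e1 /= e10 e1A] : nbhs b (fun x => A1 x%:E) by exact: A1b.
  case: d' bd A2d {pr Upr Vp} => [d'||//] bd A2d.
    have /nbhs_ballP[e2 /= e20 e2A] : nbhs d' (fun x => A2 x%:E) by exact: A2d.
    exists (Num.min e1 e2), 0; split=> //; first by rewrite lt_min e10.
    move=> x; rewrite lt_min => /andP[xb _] y [y' ->].
    rewrite lt_min => /andP[_ yd]; apply: A12; split; [exact: e1A|exact: e2A].
  case: A2d => T [_ TA]; exists e1, T; split=> // x xb y Ty.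
  by apply: A12; split; [exact: e1A|exact: TA].
have [Xi0 [a1 [a2 [c1 [c2 [delta [M [Xi00 delta0 M0 near copies]]]]]]]] :=
  copies_xi_ge kappaP kappa_lip T e0 pr.
have [r [l [[r0 l0] disj sbox snear sfar]]] := spots_choice Xi0 delta0 M0.
have mVD : measurable (V `&` Delta (R := R)).
  by apply: measurableI; [exact: measurable_open_plane|exact: measurable_Delta].
have copiesV (Xi : {fset 'rV[R]_N}) n (g : 'I_n -> Xi0 -> Xi) : near_copies delta M g ->
    (n%:R%:E <= xi kappa F q Xi (V `&` Delta (R := R)))%E.
  move=> ng; apply: copies ng _ => -[x y] xyD /and4P[/= ax xa cy yc]; split=> //.
  have [x' xE] : exists x' : R, x = x'%:E.
    by case: x ax xa {xyD} => [x' _ _||]//; exists x'.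
  subst x; rewrite !lte_fin !lee_fin in ax xa.
  case: near => na1 na2 nd; apply: near1.
    by rewrite ltr_norml; apply/andP; split; lra.
  case: d' nd {bd Upr Vp pr} => [d' [dc [c c2E cd]]|Tc|Tc]; last 2 first.
  - by apply: le_lt_trans cy; rewrite lee_fin ltW.
  - by apply: le_lt_trans cy; rewrite lee_fin ltW.
  rewrite c2E in yc; have [y' yE] : exists y' : R, y = y'%:E.
    by case: y cy yc {xyD} => [y' _ _||]//; exists y'.
  subst y; exists y' => //; rewrite !lte_fin !lee_fin in cy yc.
  by rewrite ltr_norml; apply/andP; split; lra.
have event := copies_of_event disj sbox snear sfar.
set E0 := copy_event Xi0 r l.
have Theta0 : (0 < distribution P Phi E0)%E.
  pose D : set (euclid R N) := [set x : 'rV[R]_N | forall i, `[- (l / 2), l / 2]%classic (x ord0 i)].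
  have cD : compact (D : set 'rV[R]_N).
    apply: (@rV_compact R _ (fun=> `[- (l / 2), l / 2]%classic)) => i.
    exact: segment_compact.
  have mD : measurable D.
    rewrite -[D]setCK; apply: measurableC; apply: sub_sigma_algebra; apply: closed_openC.
    by apply: compact_closed cD; exact: norm_hausdorff.
  have lD : box l `<=` D.
    by move=> x xl i; rewrite /= in_itv /=; have /andP[-> /ltW ->] := xl i.
  have pos := density_event_gt0 (Theta_abs_cont D mD cD) (density_gt0 D mD cD).
  apply: pos.
  - exact: measurable_copy_event.
  - exact: copy_event_restrict.
  - exact: poisson_copy_event PiP.
pose c : \bar R := (((2 * l) ^- N)%:E * distribution P Phi E0)%E.
have c0 : (0 < c)%E by rewrite mule_gt0// lte_fin invr_gt0 exprn_gt0// mulr_gt0.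
rewrite lt0e measure_ge0 andbT; apply/eqP => nuU.
have mUD : measurable (U `&` Delta (R := R)).
  by apply: measurableI; [exact: measurable_open_plane|exact: measurable_Delta].
have intnu : (\int[nu]_x (f x)%:E = 0)%E.
  apply: (@integral_eq0_of_null _ _ _ _ _ (U `&` Delta (R := R))) => [x|x|B mB BU].
  - by rewrite lee_fin.
  - by rewrite eqe => /fU.
  - by apply/eqP; rewrite -measure_le0 -nuU le_measure ?inE.
have intL L : l <= L -> (c <= \int[scaled_intensity P Phi kappa F q L]_x (f x)%:E)%E.
  move=> lL; apply: (@le_trans _ _ (scaled_intensity P Phi kappa F q L (V `&` Delta (R := R)))).
    exact: (scaled_intensity_ge Phi_stationary l0 copiesV event lL).
  apply: integral_ge_measure => //.
  - exact: scaled_intensity_set0.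
  - by move=> x [Vx Dx]; rewrite Vf.
have small : \forall L \near +oo, (\int[scaled_intensity P Phi kappa F q L]_x (f x)%:E < c)%E.
  have := nu_limit f fC; rewrite intnu => /(_ [set x | (x < c)%E]); apply.
  apply: open_nbhs_nbhs; split; last exact: c0.
  exact: open_ereal_lt_ereal.
have [L [lL Lc]] : exists L, l <= L /\
    (\int[scaled_intensity P Phi kappa F q L]_x (f x)%:E < c)%E.
  exact: filter_ex (filterI (nbhs_pinfty_ge (num_real l)) small).
by have := lt_le_trans Lc (intL L lL); rewrite ltxx.
Qed.
End Support.

Theorem theorem1p9 (R : realType) (N q : nat) (N_gt0 : (0 < N)%N) (F : fieldType)
  (kappa : {fset 'rV[R]_N} -> \bar R) (kappaP : filtration_function kappa)
  (d : measure_display) (Omega : measurableType d) (P : probability Omega R)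
  (Phi : {mfun Omega >-> configuration R N})
  (Phi_simple : simple_process P Phi)
  (Phi_stationary : stationary P Phi)
  (Phi_moments : all_moments_finite P Phi)
  (lambda : R) (lambda_gt0 : 0 < lambda)
  (Pi : probability (configuration R N) R) (PiP : poisson_law lambda Pi)
  (Theta_abs_cont : forall (D : set (euclid R N)) (mD : measurable D),
    compact (D : set 'rV[R]_N) ->
    distribution (distribution P Phi) (cfg_restrict mD)
      `<< distribution Pi (cfg_restrict mD))
  (density_gt0 : forall (D : set (euclid R N)) (mD : measurable D),
    compact (D : set 'rV[R]_N) ->
    {ae distribution Pi (cfg_restrict mD), forall mu,
      (0 < restricted_density mD (distribution P Phi) Pi mu)%E})
  (kappa_lip : hausdorff_lipschitz kappa)
  (nu : {measure set (\bar R * \bar R) -> \bar R})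
  (nu_radon : radon_on_Delta nu)
  (nu_limit : vague_limit (scaled_intensity P Phi kappa F q) nu) :
  support_in_Delta nu = closure_in_Delta (realizable kappa F q).
Proof.
apply/seteqP; split; first exact: (support_subset kappaP nu_limit).
exact: (closure_subset N_gt0 kappaP Phi_stationary lambda_gt0 PiP
  Theta_abs_cont density_gt0 kappa_lip nu_limit).
Qed.
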